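(* Assume $\mathrm{IGMP}(\omega_2)$. Then every $\omega_1$-preserving forcing which is proper for models of size $\omega_1$ has the $\omega_1$-approximation property. In particular, every $\omega_1$-preserving forcing of size $\omega_1$ has the $\omega_1$-approximation property.
   Context: A set $x$ is bounded in $M$ if there is $X\in M$ with $x\subseteq X$. A set $M$ is $\omega_1$-guessing if for every $x$ bounded in $M$: $a\cap x\in M$ for all countable $a\in M$ if and only if there is $x^*\in M$ with $x^*\cap M=x\cap M$. An $\omega_1$-guessing set is indestructibly $\omega_1$-guessing if it remains $\omega_1$-guessing in every $\omega_1$-preserving forcing extension. A set $\mathcal S\subseteq\mathcal P_{\omega_2}(H_\theta)$ is stationary if for every $F:\mathcal P_\omega(H_\theta)\to\mathcal P_{\omega_2}(H_\theta)$ there is $M\in\mathcal S$, $M\prec H_\theta$, $M\cap\omega_2\in\omega_2$, closed under $F$. $\mathrm{IGMP}(\omega_2)$: for every regular $\theta\geq\omega_2$ there are stationarily many $M\in\mathcal P_{\omega_2}(H_\theta)$ that are indestructibly $\omega_1$-guessing. For $M\prec H_\theta$ with $\mathbb P,\mathcal P(\mathbb P)\in M$, $p$ is $(M,\mathbb P)$-generic if for every dense $D\subseteq\mathbb P$ in $M$, $M\cap D$ is predense below $p$. $\mathbb P$ is proper for models of size $\omega_1$ if for every sufficiently large regular $\theta$, every $M\prec(H_\theta,\in,\mathbb P)$ with $\omega_1\subseteq M$ and $|M|=\omega_1$, and every $p\in M\cap\mathbb P$, there is an $(M,\mathbb P)$-generic $q\leq p$. $\mathbb P$ has the $\omega_1$-approximation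 property if for every $V$-generic $G\subseteq\mathbb P$, every $x\in V[G]$ which is bounded in $V$ and satisfies $a\cap x\in V$ for all countable $a\in V$ belongs to $V$. *)

(* Defs.v *)
(** Set theory and forcing over an arbitrary universe of sets, in plain Rocq
    with the standard library's [well_founded]. *)

From Stdlib Require Import Wellfounded FunctionalExtensionality.

Set Implicit Arguments.
Unset Strict Implicit.

(** * The universe V *)

(** Axioms of ZFC in their second-order form: separation ([sep]) and replacement
    ([image]) apply to arbitrary classes and class functions, and foundation is
    well-foundedness of membership. *)
Record universe := Universe {
  carrier :> Type;
  mem : carrier -> carrier -> Prop;
  upair : carrier -> carrier -> carrier;
  union : carrier -> carrier;
  power : carrier -> carrier;
  sep : (carrier -> Prop) -> carrier -> carrier;
  image : forall a : carrier, ({x | mem x a} -> carrier) -> carrier;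
  extensionality : forall a b, (forall x, mem x a <-> mem x b) -> a = b;
  foundation : well_founded mem;
  mem_upair : forall a b x, mem x (upair a b) <-> x = a \/ x = b;
  mem_union : forall a x, mem x (union a) <-> exists y, mem y a /\ mem x y;
  mem_power : forall a x, mem x (power a) <-> forall y, mem y x -> mem y a;
  mem_sep : forall (Q : carrier -> Prop) a x, mem x (sep Q a) <-> mem x a /\ Q x;
  mem_image : forall a (F : {x | mem x a} -> carrier) y,
    mem y (image F) <-> exists i, y = F i;
  infinity : exists w,
    (exists e, mem e w /\ forall x, ~ mem x e) /\
    (forall x, mem x w -> mem (union (upair x (upair x x))) w);
  choice : forall a,
    (forall x, mem x a -> exists y, mem y x) ->
    (forall x y z, mem x a -> mem y a -> mem z x -> mem z y -> x = y) ->
    exists c, forall x, mem x a -> exists! y, mem y x /\ mem y c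
}.

Definition opair {V : universe} (x y : V) : V := upair (upair x x) (upair x y).

(** * Formulas *)

(** Formulas of the forcing language, in higher-order abstract syntax: [X] is the
    type of individuals, to be read either as sets of V or as names.  [Ground]
    is the predicate "belongs to the ground model V". *)
Inductive fm (X : Type) : Type :=
| Mem (x y : X)
| Eq (x y : X)
| Ground (x : X)
| Not (f : fm X)
| And (f g : fm X)
| All (f : X -> fm X).

Arguments Mem {X}. Arguments Eq {X}. Arguments Ground {X}.
Arguments Not {X}. Arguments And {X}. Arguments All {X}.

Definition Or {X} (f g : fm X) := Not (And (Not f) (Not g)).
Definition Imp {X} (f g : fm X) := Not (And f (Not g)).
Definition Iff {X} (f g : fm X) := And (Imp f g) (Imp g f).
Definition Ex {X} (f : X -> fm X) := Not (All (fun x => Not (f x))).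
Definition AllIn {X} (a : X) (f : X -> fm X) := All (fun x => Imp (Mem x a) (f x)).
Definition ExIn {X} (a : X) (f : X -> fm X) := Ex (fun x => And (Mem x a) (f x)).

Declare Scope fm_scope.
Delimit Scope fm_scope with fm.
Bind Scope fm_scope with fm.
Notation "x ∈ y" := (Mem x y) (at level 70) : fm_scope.
Notation "x = y" := (Eq x y) : fm_scope.
Notation "~ f" := (Not f) : fm_scope.
Notation "f /\ g" := (And f g) : fm_scope.
Notation "f \/ g" := (Or f g) : fm_scope.
Notation "f ⇒ g" := (Imp f g) (at level 90, right associativity) : fm_scope.
Notation "f ⇔ g" := (Iff f g) (at level 95, no associativity) : fm_scope.
Notation "∀ x , f" := (All (fun x => f%fm))
  (at level 200, x name, right associativity) : fm_scope.
Notation "∃ x , f" := (Ex (fun x => f%fm))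
  (at level 200, x name, right associativity) : fm_scope.
Notation "∀ x ∈ a , f" := (AllIn a (fun x => f%fm))
  (at level 200, x name, a at level 69, right associativity) : fm_scope.
Notation "∃ x ∈ a , f" := (ExIn a (fun x => f%fm))
  (at level 200, x name, a at level 69, right associativity) : fm_scope.

Section Formulas.
Local Open Scope fm_scope.
Context {X : Type}.
Implicit Types a b f m s u v w x y z : X.

Definition Subset x y : fm X := ∀ z ∈ x, z ∈ y.
Definition IsInter z x y : fm X := ∀ u, u ∈ z ⇔ u ∈ x /\ u ∈ y.
Definition IsUpair z x y : fm X := ∀ u, u ∈ z ⇔ u = x \/ u = y.
Definition IsOpair z x y : fm X :=
  ∃ u, ∃ v, IsUpair u x x /\ IsUpair v x y /\ IsUpair z u v.
Definition MapsTo f x y : fm X := ∃ z ∈ f, IsOpair z x y.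

Definition IsInjection f a b : fm X :=
  (∀ z ∈ f, ∃ x ∈ a, ∃ y ∈ b, IsOpair z x y) /\
  (∀ x ∈ a, ∃ y ∈ b, MapsTo f x y) /\
  (∀ x, ∀ y, ∀ u, ∀ v, MapsTo f x y /\ MapsTo f u v ⇒ (x = u ⇔ y = v)).
Definition Injects a b : fm X := ∃ f, IsInjection f a b.
Definition Equipotent a b : fm X := Injects a b /\ Injects b a.

Definition IsInductive w : fm X :=
  (∃ x ∈ w, ∀ z, ~ z ∈ x) /\ (∀ x ∈ w, ∃ s ∈ w, ∀ z, z ∈ s ⇔ z ∈ x \/ z = x).
Definition IsOmega w : fm X := IsInductive w /\ (∀ y, IsInductive y ⇒ Subset w y).
Definition Finite a : fm X := ∃ w, IsOmega w /\ (∃ n ∈ w, Injects a n).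
Definition Countable a : fm X := ∃ w, IsOmega w /\ Injects a w.

Definition Transitive x : fm X := ∀ y ∈ x, Subset y x.
Definition Ordinal x : fm X := Transitive x /\ (∀ y ∈ x, Transitive y).
Definition IsOmega1 w : fm X :=
  Ordinal w /\ ~ Countable w /\ (∀ x ∈ w, Countable x).
Definition IsOmega2 w : fm X :=
  Ordinal w /\
  (∃ w1, IsOmega1 w1 /\ ~ Injects w w1 /\ (∀ x ∈ w, Injects x w1)).

Definition BoundedIn x m : fm X := ∃ y ∈ m, Subset x y.

(** "m is omega_1-guessing". *)
Definition Guessing m : fm X :=
  ∀ x, BoundedIn x m ⇒
    ((∀ a ∈ m, Countable a ⇒ (∃ b ∈ m, IsInter b a x)) ⇔
     (∃ y ∈ m, ∀ z, z ∈ y /\ z ∈ m ⇔ z ∈ x /\ z ∈ m)).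

(** "x is bounded in V", and "the intersection of a and x is in V". *)
Definition BoundedInGround x : fm X := ∃ y, Ground y /\ Subset x y.
Definition InterInGround a x : fm X := ∃ b, Ground b /\ IsInter b a x.

End Formulas.

(** Truth in V. *)
Fixpoint holds {V : universe} (f : fm V) : Prop :=
  match f with
  | Mem x y => mem x y
  | Eq x y => x = y
  | Ground _ => True
  | Not f => ~ holds f
  | And f g => holds f /\ holds g
  | All f => forall x, holds (f x)
  end.

(** * Forcing *)

(** A forcing notion is a nonempty preordered set of V; no greatest condition is
    required. *)
Record forcing (V : universe) := Forcing {
  cond : V;
  leq : V;
  cond_nonempty : exists p, mem p cond;
  leq_cond : forall z, mem z leq ->
    exists p q, mem p cond /\ mem q cond /\ z = opair p q;
  leq_refl : forall p, mem p cond -> mem (opair p p) leq;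
  leq_trans : forall p q r,
    mem (opair p q) leq -> mem (opair q r) leq -> mem (opair p r) leq
}.

Section Forcing.
Context {V : universe} (P : forcing V).
Implicit Types p q r s x y sigma tau pi rho : V.

Definition le p q : Prop := mem (opair p q) (leq P).
Definition compatible p q : Prop := exists r, le r p /\ le r q.

Definition dense D : Prop :=
  (forall p, mem p D -> mem p (cond P)) /\
  (forall p, mem p (cond P) -> exists q, mem q D /\ le q p).

(** Every set is a P-name, with [val_G tau = {val_G pi | (pi, s) in tau, s in G}];
    elements of [tau] which are not of the form (pi, s) with s in P are
    ignored. *)
Definition name_mem pi s tau : Prop := mem (opair pi s) tau /\ mem s (cond P).

(** The canonical name [{(check y, p) | y in x, p in P}] of x. *)
Definition check : V -> V :=
  Fix (foundation (u := V)) (fun _ => carrier V) (fun x rec =>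
    union (image (fun y : {y | mem y x} =>
      image (fun p : {p | mem p (cond P)} =>
        opair (rec (proj1_sig y) (proj2_sig y)) (proj1_sig p))))).

Lemma mem_check x z :
  mem z (check x) <-> exists y p, mem y x /\ mem p (cond P) /\ z = opair (check y) p.
Proof.
  unfold check at 1; rewrite Fix_eq; fold check.
  - rewrite mem_union; split.
    + intros [t [Ht Hz]].
      apply mem_image in Ht as [[y Hy] ->].
      apply mem_image in Hz as [[p Hp] ->].
      exists y, p; simpl; auto.
    + intros (y & p & Hy & Hp & ->).
      exists (image (fun q : {q | mem q (cond P)} => opair (check y) (proj1_sig q))).
      split; apply mem_image.
      * now exists (exist _ y Hy).
      * now exists (exist _ p Hp).
  - intros a f g Hfg.
    replace g with f; auto.
    extensionality b; extensionality h; apply Hfg.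
Qed.

(** [p] forces [sigma = tau]: below [p], every element of either name is densely
    forced to be equal to an element of the other.  The recursion is along the
    well-founded relation of V, so that this least fixed point is the usual
    recursive definition. *)
Inductive forces_eq : V -> V -> V -> Prop :=
| Forces_eq p sigma tau :
    (forall pi s, name_mem pi s sigma -> forall q, le q p -> le q s ->
       exists r, le r q /\ exists rho t, name_mem rho t tau /\ le r t /\ forces_eq r pi rho) ->
    (forall rho t, name_mem rho t tau -> forall q, le q p -> le q t ->
       exists r, le r q /\ exists pi s, name_mem pi s sigma /\ le r s /\ forces_eq r pi rho) ->
    forces_eq p sigma tau.

Fixpoint forces p (f : fm V) : Prop :=
  match f with
  | Mem sigma tau => forall q, le q p -> exists r, le r q /\
      exists pi s, name_mem pi s tau /\ le r s /\ forces_eq r sigma pi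
  | Eq sigma tau => forces_eq p sigma tau
  | Ground sigma => forall q, le q p -> exists r, le r q /\
      exists x, forces_eq r sigma (check x)
  | Not f => forall q, le q p -> ~ forces q f
  | And f g => forces p f /\ forces p g
  | All f => forall sigma, forces p (f sigma)
  end.

(** Truth in every forcing extension by P. *)
Definition forced (f : fm V) : Prop := forall p, mem p (cond P) -> forces p f.

Definition preserves_omega1 : Prop :=
  forall w1, holds (IsOmega1 w1) -> forced (IsOmega1 (check w1)).

(** A set x of the extension with name [sigma] is considered below each condition
    forcing that x satisfies the hypotheses; a ranges over the sets of V that
    are countable in V. *)
Definition omega1_approximation : Prop :=
  forall p sigma, mem p (cond P) ->
    forces p (BoundedInGround sigma) ->
    (forall a, holds (Countable a) -> forces p (InterInGround (check a) sigma)) ->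
    forces p (Ground sigma).

End Forcing.

(** * Hereditary size and elementarity *)

Section Models.
Context {V : universe}.
Implicit Types a e m t w x theta : V.

Definition card_lt a b : Prop := holds (Injects a b) /\ ~ holds (Injects b a).

(** Infinite regular cardinals: every function from a smaller ordinal into theta
    is (strictly) bounded in theta. *)
Definition regular theta : Prop :=
  holds (Ordinal theta) /\
  (forall w, holds (IsOmega w) -> holds (Subset w theta)) /\
  (forall a (F : V -> V), mem a theta ->
     (forall x, mem x a -> mem (F x) theta) ->
     exists b, mem b theta /\ forall x, mem x a -> mem (F x) b).

Definition is_transitive_closure t x : Prop :=
  holds (Transitive t) /\ holds (Subset x t) /\
  forall u, holds (Transitive u) -> holds (Subset x u) -> holds (Subset t u).

(** The sets of hereditary cardinality less than [theta]. *)
Definition H theta x : Prop := exists t, is_transitive_closure t x /\ card_lt t theta.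

End Models.

(** First-order formulas of the language of set theory, with de Bruijn indices. *)
Inductive formula : Type :=
| FMem (i j : nat)
| FEq (i j : nat)
| FNot (f : formula)
| FAnd (f g : formula)
| FAll (f : formula).

Definition scons {A : Type} (x : A) (e : nat -> A) (n : nat) : A :=
  match n with 0 => x | S k => e k end.

(** Satisfaction in the structure (D, mem). *)
Fixpoint sat {V : universe} (D : V -> Prop) (e : nat -> V) (f : formula) : Prop :=
  match f with
  | FMem i j => mem (e i) (e j)
  | FEq i j => e i = e j
  | FNot f => ~ sat D e f
  | FAnd f g => sat D e f /\ sat D e g
  | FAll f => forall x, D x -> sat D (scons x e) f
  end.

Definition elementary {V : universe} (m : V) (D : V -> Prop) : Prop :=
  (exists x, mem x m) /\
  (forall x, mem x m -> D x) /\
  (forall f e, (forall i, mem (e i) m) -> (sat (fun x => mem x m) e f <-> sat D e f)).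

(** * Guessing models *)

Section Guessing.
Context {V : universe}.
Implicit Types e m w theta : V.

Definition in_Pomega (D : V -> Prop) e : Prop :=
  (forall x, mem x e -> D x) /\ holds (Finite e).

Definition in_Pomega2 (D : V -> Prop) m : Prop :=
  (forall x, mem x m -> D x) /\ forall w2, holds (IsOmega2 w2) -> card_lt m w2.

(** [m] is closed under [F] when [F e] is a subset of [m] for all finite subsets
    [e] of [m]. *)
Definition closed_under (F : V -> V) m : Prop :=
  forall e, in_Pomega (fun x => mem x m) e -> holds (Subset (F e) m).

(** Stationarity in P_{omega_2}(H_theta) of the members of [S] lying in it. *)
Definition stationary (theta : V) (S : V -> Prop) : Prop :=
  forall F : V -> V,
    (forall e, in_Pomega (H theta) e -> in_Pomega2 (H theta) (F e)) ->
    exists m, in_Pomega2 (H theta) m /\ S m /\ elementary m (H theta) /\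
      (forall w2, holds (IsOmega2 w2) ->
         exists a, mem a w2 /\ holds (IsInter a m w2)) /\
      closed_under F m.

Definition indestructibly_guessing m : Prop :=
  holds (Guessing m) /\
  forall P : forcing V, preserves_omega1 P -> forced P (Guessing (check P m)).

End Guessing.

Definition IGMP_omega2 (V : universe) : Prop :=
  forall w2 theta : V, holds (IsOmega2 w2) -> regular theta ->
    holds (Subset w2 theta) ->
    stationary theta indestructibly_guessing.

(** * Properness *)

Section Proper.
Context {V : universe} (P : forcing V).

Definition generic_condition (m q : V) : Prop :=
  mem q (cond P) /\
  forall D, mem D m -> dense P D ->
    forall r, le P r q -> exists d, mem d m /\ mem d D /\ compatible P r d.

(** Elementarity of [m] in (H_theta, mem, P), with (P, leq) named by a constant,
    amounts to elementarity in H_theta together with (P, leq) in [m]. *)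
Definition proper_for_size_omega1 : Prop :=
  exists theta0 : V, holds (Ordinal theta0) /\
    forall theta, regular theta -> mem theta0 theta ->
    forall m, elementary m (H theta) -> mem (opair (cond P) (leq P)) m ->
      (forall w1, holds (IsOmega1 w1) -> holds (Subset w1 m) /\ holds (Equipotent m w1)) ->
      forall p, mem p m -> mem p (cond P) ->
        exists q, le P q p /\ generic_condition m q.

Definition has_size_omega1 : Prop :=
  forall w1 : V, holds (IsOmega1 w1) -> holds (Equipotent (cond P) w1).

End Proper.

(* Main.v *)
From Stdlib Require Import Relations Wellfounded Classical ClassicalEpsilon
  FunctionalExtensionality PropExtensionality List.
Require Import Defs.
Import ListNotations.

Set Implicit Arguments.
Unset Strict Implicit.

(** Let [q1] force [sigma] to be a subset of [y] whose intersections with the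
    countable sets of V lie in V, and let [m] be an indestructibly guessing model
    containing the relevant parameters.  Below an (m, P)-generic [q <= q1], every
    intersection of [sigma] with a countable element of [m] is decided by a
    condition in [m], hence lies in [m]; so some [u] in [m] agrees with [sigma]
    on [m].  The conditions which either force [sigma] to be [u] intersected with
    [y], or force a specific element of [y] to lie in exactly one of [u] and
    [sigma], are dense; one of them, lying in [m], is compatible with [q].  The
    second alternative is impossible, as the element could be found in [m].

    Closing [m] under choice functions which return these dense sets and
    witnesses is what the freedom of [F] in stationarity is used for; thus the
    forcing relation need not be definable in H_theta. *)

Section Sets.
Context {V : universe}.
Implicit Types a b e f m t w x y z A theta : V.

(** * Truth in V of the coded formulas *)

Lemma holds_Imp (f g : fm V) : holds (Imp f g) <-> (holds f -> holds g).
Proof. cbn; split; [intros H ?; apply NNPP|]; tauto. Qed.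

Lemma holds_Iff (f g : fm V) : holds (Iff f g) <-> (holds f <-> holds g).
Proof. unfold Iff; cbn [holds]; rewrite !holds_Imp; tauto. Qed.

Lemma holds_Or (f g : fm V) : holds (Or f g) <-> (holds f \/ holds g).
Proof. cbn; split; [intros H; apply NNPP|]; tauto. Qed.

Lemma holds_Ex (f : V -> fm V) : holds (Ex f) <-> exists x, holds (f x).
Proof. cbn; split; [apply not_all_not_ex | firstorder]. Qed.

Lemma holds_AllIn a (f : V -> fm V) :
  holds (AllIn a f) <-> forall x, mem x a -> holds (f x).
Proof.
  unfold AllIn; cbn [holds]; setoid_rewrite holds_Imp; reflexivity.
Qed.

Lemma holds_ExIn a (f : V -> fm V) :
  holds (ExIn a f) <-> exists x, mem x a /\ holds (f x).
Proof. unfold ExIn; rewrite holds_Ex; reflexivity. Qed.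

Lemma holds_Subset x y : holds (Subset x y) <-> forall z, mem z x -> mem z y.
Proof. apply holds_AllIn. Qed.

Lemma holds_IsInter z x y :
  holds (IsInter z x y) <-> forall u, mem u z <-> mem u x /\ mem u y.
Proof. unfold IsInter; cbn [holds]; setoid_rewrite holds_Iff; reflexivity. Qed.

Lemma holds_Transitive x :
  holds (Transitive x) <-> forall y, mem y x -> forall z, mem z y -> mem z x.
Proof.
  unfold Transitive; rewrite holds_AllIn; setoid_rewrite holds_Subset; reflexivity.
Qed.

Lemma holds_IsUpair z x y : holds (IsUpair z x y) <-> z = upair x y.
Proof.
  unfold IsUpair; cbn [holds]; setoid_rewrite holds_Iff; setoid_rewrite holds_Or.
  cbn [holds]; split.
  - intros H; apply extensionality; intros u; rewrite mem_upair; apply H.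
  - intros -> u; apply mem_upair.
Qed.

Lemma holds_IsOpair z x y : holds (IsOpair z x y) <-> z = opair x y.
Proof.
  unfold IsOpair; rewrite holds_Ex; setoid_rewrite holds_Ex; cbn [holds].
  setoid_rewrite holds_IsUpair.
  split; [intros (u & v & -> & -> & ->) | intros ->; do 2 eexists]; easy.
Qed.

Lemma holds_MapsTo f x y : holds (MapsTo f x y) <-> mem (opair x y) f.
Proof.
  unfold MapsTo; rewrite holds_ExIn; setoid_rewrite holds_IsOpair.
  split; [intros (? & ? & ->) | eexists]; eauto.
Qed.

Lemma upair_inj a b x y :
  upair a b = upair x y -> (a = x /\ b = y) \/ (a = y /\ b = x).
Proof.
  intros H.
  assert (Ha : mem a (upair x y)) by (rewrite <- H; apply mem_upair; auto).
  assert (Hb : mem b (upair x y)) by (rewrite <- H; apply mem_upair; auto).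
  assert (Hx : mem x (upair a b)) by (rewrite H; apply mem_upair; auto).
  assert (Hy : mem y (upair a b)) by (rewrite H; apply mem_upair; auto).
  apply mem_upair in Ha, Hb, Hx, Hy.
  intuition congruence.
Qed.

Lemma opair_inj a b x y : opair a b = opair x y -> a = x /\ b = y.
Proof.
  intros H; apply upair_inj in H as [[H1 H2]|[H1 H2]];
    apply upair_inj in H1, H2; intuition congruence.
Qed.

(** [inj a b] is read off arbitrary functions of the metatheory; by replacement
    it agrees with [Injects]. *)
Definition inj a b : Prop :=
  exists f : V -> V, (forall x, mem x a -> mem (f x) b) /\
    forall x y, mem x a -> mem y a -> f x = f y -> x = y.

Lemma inj_trans a b x : inj a b -> inj b x -> inj a x.
Proof.
  intros (f & Hf & If) (g & Hg & Ig).
  exists (fun z => g (f z)); split; auto 6.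
Qed.

Lemma inj_subset a b : (forall x, mem x a -> mem x b) -> inj a b.
Proof. intros H; exists (fun x => x); auto. Qed.

(** Choice comes from the metatheory's [epsilon]; [d] supplies the inhabitant it asks for, so [F] is
    total, with unspecified values where no witness exists. *)
Lemma choose (T : Type) (P : V -> T -> Prop) (d : T) :
  exists F : V -> T, forall x, (exists c, P x c) -> P x (F x).
Proof.
  exists (fun x => epsilon (inhabits d) (P x)).
  intros x; apply epsilon_spec.
Qed.

Definition range a (F : V -> V) : V := image (fun x : {x | mem x a} => F (proj1_sig x)).

Lemma mem_range a F y : mem y (range a F) <-> exists x, mem x a /\ y = F x.
Proof.
  unfold range; rewrite mem_image; split.
  - intros [[x Hx] ->]; eauto.
  - intros (x & Hx & ->); now exists (exist _ x Hx).
Qed.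

Lemma holds_Injects a b : holds (Injects a b) <-> inj a b.
Proof.
  unfold Injects, IsInjection; rewrite holds_Ex; cbn [holds].
  setoid_rewrite holds_AllIn.
  repeat setoid_rewrite holds_ExIn.
  setoid_rewrite holds_Imp; setoid_rewrite holds_Iff; cbn [holds].
  setoid_rewrite holds_IsOpair; setoid_rewrite holds_MapsTo.
  split.
  - intros (f & Hf & Ht' & Hi).
    assert (Ht : forall x, mem x a -> exists y, mem y b /\ mem (opair x y) f).
    { intros x Hx; destruct (Ht' x Hx) as (y & Hy & ? & Hz & ->); eauto. }
    destruct (choose (fun x y => mem y b /\ mem (opair x y) f) a) as [F HF].
    exists F; split.
    + intros x Hx; now apply HF, Ht.
    + intros x y Hx Hy E.
      destruct (HF x) as [_ H1]; [now apply Ht|].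
      destruct (HF y) as [_ H2]; [now apply Ht|].
      now apply (Hi x (F x) y (F y)).
  - intros (F & HF & IF).
    exists (range a (fun x => opair x (F x))); split; [|split].
    + intros z Hz; apply mem_range in Hz as (x & Hx & ->); eauto 6.
    + intros x Hx; exists (F x); split; auto.
      exists (opair x (F x)); split; auto; apply mem_range; eauto.
    + intros x y u v [H1 H2].
      apply mem_range in H1 as (x' & Hx & [-> ->]%opair_inj).
      apply mem_range in H2 as (y' & Hy & [-> ->]%opair_inj).
      split; [now intros -> | auto].
Qed.

Lemma mem_irrefl x : ~ mem x x.
Proof.
  induction x as [x IH] using (well_founded_ind (foundation (u := V))).
  intros H; exact (IH x H H).
Qed.

Lemma mem_asym x y : mem x y -> ~ mem y x.
Proof.
  revert y; induction x as [x IH] using (well_founded_ind (foundation (u := V))).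
  intros y H1 H2; exact (IH y H2 x H2 H1).
Qed.

(** * Natural numbers *)


Definition omega0 : V := proj1_sig (constructive_indefinite_description _ (infinity V)).
Definition empty : V := sep (fun _ => False) omega0.
Definition succ x : V := union (upair x (upair x x)).
Fixpoint num (n : nat) : V := match n with 0 => empty | S n => succ (num n) end.
(** [omega0] is some inductive set and may contain more than numerals. Cutting it down to the values
    of [num] turns induction over omega into induction over [nat]. *)
Definition omega : V := sep (fun x => exists n, x = num n) omega0.

Lemma mem_empty x : ~ mem x empty.
Proof. unfold empty; rewrite mem_sep; tauto. Qed.

Lemma empty_unique x : (forall y, ~ mem y x) -> x = empty.
Proof.
  intros H; apply extensionality; intros y; split; intros Hy; exfalso.
  - now apply (H y).
  - now apply (mem_empty Hy).
Qed.

Lemma mem_succ x y : mem y (succ x) <-> mem y x \/ y = x.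
Proof.
  unfold succ; rewrite mem_union; setoid_rewrite mem_upair; split.
  - intros (z & [-> | ->] & H); [auto|]; rewrite mem_upair in H; tauto.
  - intros [H | ->]; [exists x | exists (upair x x)]; rewrite ?mem_upair; auto.
Qed.

Lemma succ_inj x y : succ x = succ y -> x = y.
Proof.
  intros H.
  assert (Hx : mem x (succ y)) by (rewrite <- H; apply mem_succ; auto).
  assert (Hy : mem y (succ x)) by (rewrite H; apply mem_succ; auto).
  apply mem_succ in Hx as [Hx|]; [|easy]; apply mem_succ in Hy as [Hy|]; [|easy].
  now destruct (mem_asym Hx Hy).
Qed.

Lemma num_inj n k : num n = num k -> n = k.
Proof.
  revert k; induction n as [|n IH]; intros [|k] H; cbn in H; auto.
  - exfalso; apply (@mem_empty (num k)); rewrite H; apply mem_succ; auto.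
  - exfalso; apply (@mem_empty (num n)); rewrite <- H; apply mem_succ; auto.
  - f_equal; apply IH, succ_inj, H.
Qed.

Lemma mem_omega x : mem x omega <-> exists n, x = num n.
Proof.
  unfold omega, omega0; rewrite mem_sep.
  destruct (constructive_indefinite_description _ (infinity V)) as (w & (z & Hz & Ez) & Hs).
  cbn; split; [tauto|]; intros [n ->]; split; [|eauto].
  induction n as [|n IH]; cbn; [|now apply Hs].
  rewrite <- (empty_unique Ez); apply Hz.
Qed.

Lemma holds_IsInductive w :
  holds (IsInductive w) <-> mem empty w /\ forall x, mem x w -> mem (succ x) w.
Proof.
  unfold IsInductive; cbn [holds]; rewrite holds_ExIn, holds_AllIn.
  setoid_rewrite holds_ExIn; cbn [holds]; setoid_rewrite holds_Iff.
  setoid_rewrite holds_Or; cbn [holds]; split; intros [He Hs]; split.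
  - destruct He as (x & Hx & E); now rewrite <- (empty_unique E).
  - intros x Hx; destruct (Hs x Hx) as (s & Hw & E).
    replace (succ x) with s; auto.
    apply extensionality; intros z; rewrite E, mem_succ; reflexivity.
  - exists empty; split; [easy|]; intros x; apply mem_empty.
  - intros x Hx; exists (succ x); split; [auto|]; intros z; apply mem_succ.
Qed.

Lemma holds_IsOmega w : holds (IsOmega w) <-> w = omega.
Proof.
  assert (Ho : holds (IsInductive omega)).
  { apply holds_IsInductive; split.
    - apply mem_omega; now exists 0.
    - intros x [n ->]%mem_omega; apply mem_omega; now exists (S n). }
  unfold IsOmega; cbn [holds]; setoid_rewrite holds_Imp; setoid_rewrite holds_Subset.
  assert (Hm : forall y, holds (IsInductive y) -> forall z, mem z omega -> mem z y).
  { intros y [H0 H1]%holds_IsInductive z [n ->]%mem_omega.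
    induction n; cbn; auto. }
  split; [intros [H1 H2] | intros ->; auto].
  apply extensionality; intros z; split; [apply H2, Ho | apply Hm, H1].
Qed.

Lemma holds_Countable a : holds (Countable a) <-> inj a omega.
Proof.
  unfold Countable; rewrite holds_Ex; cbn [holds]; setoid_rewrite holds_IsOmega.
  setoid_rewrite holds_Injects; split; [intros (w & -> & H) | exists omega]; auto.
Qed.

Lemma holds_Finite a : holds (Finite a) <-> exists n, inj a (num n).
Proof.
  unfold Finite; rewrite holds_Ex; cbn [holds]; setoid_rewrite holds_IsOmega.
  setoid_rewrite holds_ExIn; setoid_rewrite holds_Injects; split.
  - intros (w & -> & x & Hx & H); apply mem_omega in Hx as [n ->]; eauto.
  - intros [n H]; exists omega; split; auto; exists (num n); split; auto.
    apply mem_omega; eauto.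
Qed.

Lemma finite_upair x y : holds (Finite (upair x y)).
Proof.
  apply holds_Finite; exists 2.
  exists (fun z => if excluded_middle_informative (z = x) then num 0 else num 1); split.
  - intros z _; cbn; rewrite !mem_succ.
    destruct excluded_middle_informative; auto.
  - intros u v Hu Hv; apply mem_upair in Hu, Hv.
    do 2 destruct excluded_middle_informative; intros E; try apply num_inj in E;
      intuition congruence.
Qed.

(** Replacement needs a set as domain, so the sequence is indexed by [omega], and [epsilon] decodes
    the numerals. *)
Definition seqset (g : nat -> V) : V :=
  range omega (fun x => g (epsilon (inhabits 0) (fun n => x = num n))).

Lemma mem_seqset g x : mem x (seqset g) <-> exists n, x = g n.
Proof.
  assert (E : forall n, epsilon (inhabits 0) (fun k => num n = num k) = n).
  { intros n; symmetry; apply num_inj.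
    apply (epsilon_spec (inhabits 0) (fun k => num n = num k)); eauto. }
  unfold seqset; rewrite mem_range; split.
  - intros (y & [n ->]%mem_omega & ->); rewrite E; eauto.
  - intros [n ->]; exists (num n); rewrite mem_omega, E; eauto.
Qed.

Lemma inj_seqset g : inj (seqset g) omega.
Proof.
  destruct (choose (fun x n => x = g n) 0) as [k Hk].
  exists (fun x => num (k x)); split.
  - intros x _; apply mem_omega; eauto.
  - intros x y Hx Hy E; apply mem_seqset in Hx, Hy.
    rewrite (Hk x Hx), (Hk y Hy); f_equal; apply num_inj, E.
Qed.

(** * Ordinals *)

Definition transitive x : Prop := forall y, mem y x -> forall z, mem z y -> mem z x.
Definition ordinal x : Prop := transitive x /\ forall y, mem y x -> transitive y.

Lemma holds_Ordinal x : holds (Ordinal x) <-> ordinal x.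
Proof.
  unfold Ordinal; cbn [holds]; rewrite holds_AllIn, holds_Transitive.
  setoid_rewrite holds_Transitive; reflexivity.
Qed.

Lemma ordinal_mem x y : ordinal x -> mem y x -> ordinal y.
Proof. intros [Ht Hm] H; split; auto; intros z Hz; apply Hm, (Ht y); auto. Qed.

(** Nested membership induction: if neither ordinal is an element of the other, the induction
    hypotheses place every element of each in the other. *)
Lemma ordinal_linear x y : ordinal x -> ordinal y -> mem x y \/ x = y \/ mem y x.
Proof.
  revert y; induction x as [x IHx] using (well_founded_ind (foundation (u := V))).
  intros y; induction y as [y IHy] using (well_founded_ind (foundation (u := V))).
  intros Hx Hy; apply NNPP; intros N; apply N; right; left.
  apply extensionality; intros z; split; intros Hz.
  - destruct (IHx z Hz y (ordinal_mem Hx Hz) Hy) as [|[-> |H]]; auto; [tauto|].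
    destruct N; right; right; apply (proj1 Hx z); auto.
  - destruct (IHy z Hz Hx (ordinal_mem Hy Hz)) as [H|[<- |H]]; auto; [|tauto].
    destruct N; left; apply (proj1 Hy z); auto.
Qed.

(** Transfinite enumeration of [a] by a choice function. *)
Lemma enumeration a : exists h : V -> V, forall y,
  (forall u, mem u a -> exists z, mem z y /\ u = h z) \/
  (mem (h y) a /\ forall z, mem z y -> h y <> h z).
Proof.
  (* The recursion runs over all sets, not only ordinals: [h y] avoids the values at elements of [y]
     as long as [a] is not exhausted. *)
  pose (h := Fix (foundation (u := V)) (fun _ => carrier V)
    (fun y rec => epsilon (inhabits empty)
      (fun u => mem u a /\ forall z (h : mem z y), u <> rec z h))).
  assert (E : forall y, h y = epsilon (inhabits empty)
    (fun u => mem u a /\ forall z, mem z y -> u <> h z)).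
  { intros y; unfold h at 1; rewrite Fix_eq; [reflexivity|].
    intros z f g Hfg; f_equal.
    apply functional_extensionality; intros u.
    apply propositional_extensionality.
    setoid_rewrite Hfg; reflexivity. }
  exists h; intros y.
  destruct (classic (exists u, mem u a /\ forall z, mem z y -> u <> h z)) as [H|N].
  - right; rewrite E; exact (epsilon_spec (inhabits empty) _ H).
  - left; intros u Hu; apply NNPP; intros N'; apply N; exists u; split; auto.
    intros z Hz ->; apply N'; eauto.
Qed.

Lemma surj_inj a b (h : V -> V) :
  (forall u, mem u a -> exists z, mem z b /\ u = h z) -> inj a b.
Proof.
  intros H; destruct (choose (fun u z => mem z b /\ u = h z) empty) as [f Hf].
  exists f; split.
  - intros u Hu; apply Hf; auto.
  - intros u v Hu Hv E.
    destruct (Hf u (H u Hu)) as [_ ->]; destruct (Hf v (H v Hv)) as [_ ->].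
    now rewrite E.
Qed.

Lemma ordinals_inj (h : V -> V) (Q : V -> Prop) :
  (forall y, Q y -> ordinal y) -> (forall y z, Q y -> mem z y -> h y <> h z) ->
  forall y z, Q y -> Q z -> h y = h z -> y = z.
Proof.
  intros HQ Hn y z Hy Hz E.
  destruct (ordinal_linear (HQ y Hy) (HQ z Hz)) as [M|[M|M]]; auto.
  - now destruct (Hn z y Hz M).
  - now destruct (Hn y z Hy M).
Qed.

(** Enumerate [a] along [x]. Either [a] is exhausted at a stage [y] in [x], and choosing preimages
    injects it into [y], or every value is new and the enumeration is injective on [x]. *)
Lemma ordinal_or_inj x a : ordinal x -> inj x a \/ exists y, mem y x /\ inj a y.
Proof.
  intros Hx; destruct (enumeration a) as [h Hh].
  destruct (classic (exists y, mem y x /\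
    forall u, mem u a -> exists z, mem z y /\ u = h z)) as [(y & Hy & H)|N].
  - right; exists y; split; auto; apply (surj_inj H).
  - left; exists h.
    assert (S : forall y, mem y x -> mem (h y) a /\ forall z, mem z y -> h y <> h z).
    { intros y Hy; destruct (Hh y); auto; destruct N; eauto. }
    split; [intros y Hy; now apply S|].
    apply (@ordinals_inj h (fun y => mem y x)).
    + intros y; now apply ordinal_mem.
    + intros y z Hy; now apply S.
Qed.

(** Burali-Forti: otherwise the ordinals would be enumerated by elements of [a]. *)
Lemma well_orderable a : exists x, ordinal x /\ inj a x.
Proof.
  destruct (enumeration a) as [h Hh]; apply NNPP; intros N.
  assert (S : forall y, ordinal y -> mem (h y) a /\ forall z, mem z y -> h y <> h z).
  { intros y Hy; destruct (Hh y) as [H|]; auto; destruct N.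
    exists y; split; auto; apply (surj_inj H). }
  destruct (choose (fun u y => ordinal y /\ h y = u) empty) as [g Hg].
  (* Every ordinal is recovered from its value in [a], so replacement collects all ordinals in a
     set, which would be an ordinal and an element of itself. *)
  pose (O := sep ordinal (range a g)).
  assert (HO : forall y, mem y O <-> ordinal y).
  { intros y; unfold O; rewrite mem_sep, mem_range; split; [tauto|].
    intros Hy; split; auto; exists (h y); split; [now apply S|].
    destruct (Hg (h y)) as [Ho E]; [eauto|].
    symmetry; apply (@ordinals_inj h ordinal); auto.
    intros y' z Hy'; now apply S. }
  apply (@mem_irrefl O), HO; split.
  - intros y Hy z Hz; apply HO in Hy; apply HO; apply (ordinal_mem Hy Hz).
  - intros y Hy; apply HO in Hy; exact (proj1 Hy).
Qed.

(** * Cantor's theorem and Hartogs numbers *)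

Lemma cantor a : ~ inj (power a) a.
Proof.
  intros (f & Hf & If).
  pose (D := sep (fun u => exists b, mem b (power a) /\ f b = u /\ ~ mem u b) a).
  assert (HD : mem D (power a)).
  { apply mem_power; intros u Hu; apply mem_sep in Hu; tauto. }
  assert (E : mem (f D) D <-> ~ mem (f D) D).
  { unfold D at 2; rewrite mem_sep; split.
    - intros (_ & b & Hb & E & N); now rewrite (If b D Hb HD E) in N.
    - intros N; split; eauto. }
  tauto.
Qed.

(** Serves for three successor cardinals: omega_1 over [omega], omega_2 over omega_1, and the
    regular [theta] over a large set [A]. *)
Definition is_hartogs A theta : Prop := forall x, mem x theta <-> ordinal x /\ inj x A.

(** The ordinals injecting into [A] lie below any ordinal into which the power set of [A] injects,
    by [cantor]; so separation suffices. *)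
Lemma hartogs A : exists theta, is_hartogs A theta.
Proof.
  destruct (well_orderable (power A)) as (y & Hy & Iy).
  exists (sep (fun x => ordinal x /\ inj x A) y); intros x.
  rewrite mem_sep; split; [tauto|]; intros [Hx Ix]; split; auto.
  destruct (ordinal_linear Hx Hy) as [H|H]; auto.
  destruct (@cantor A); apply (inj_trans Iy), (fun I => inj_trans I Ix), inj_subset.
  destruct H as [-> |H]; auto; apply (proj1 Hx), H.
Qed.

Lemma hartogs_ordinal A theta : is_hartogs A theta -> ordinal theta.
Proof.
  intros H; split.
  - intros y Hy z Hz; apply H in Hy as [Oy Iy]; apply H; split.
    + apply (ordinal_mem Oy Hz).
    + apply (fun I => inj_trans I Iy), inj_subset, (proj1 Oy), Hz.
  - intros y Hy; apply H in Hy; exact (proj1 (proj1 Hy)).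
Qed.

Lemma hartogs_not_inj A theta : is_hartogs A theta -> ~ inj theta A.
Proof.
  intros H I; apply (@mem_irrefl theta), H; split; auto; apply (hartogs_ordinal H).
Qed.

Lemma inj_hartogs A theta : is_hartogs A theta -> inj A theta.
Proof.
  intros H; pose proof (hartogs_ordinal H) as O.
  destruct (ordinal_or_inj A O) as [I|(y & Hy & I)].
  - now destruct (hartogs_not_inj H).
  - apply (inj_trans I), inj_subset, (proj1 O), Hy.
Qed.

(** * The cardinals omega_1 and omega_2 *)

Lemma holds_IsOmega1 x : holds (IsOmega1 x) <->
  ordinal x /\ ~ inj x omega /\ forall y, mem y x -> inj y omega.
Proof.
  unfold IsOmega1; cbn [holds]; rewrite holds_AllIn, holds_Ordinal, holds_Countable.
  setoid_rewrite holds_Countable; tauto.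
Qed.

Lemma holds_IsOmega2 x : holds (IsOmega2 x) <-> ordinal x /\ exists w,
  holds (IsOmega1 w) /\ ~ inj x w /\ forall y, mem y x -> inj y w.
Proof.
  unfold IsOmega2; cbn [holds]; rewrite holds_Ex, holds_Ordinal; cbn [holds].
  setoid_rewrite holds_AllIn; setoid_rewrite holds_Injects; firstorder.
Qed.

Lemma hartogs_omega1 w : is_hartogs omega w -> holds (IsOmega1 w).
Proof.
  intros H; apply holds_IsOmega1; split; [apply (hartogs_ordinal H)|].
  split; [apply (hartogs_not_inj H)|]; intros y Hy; now apply H in Hy.
Qed.

Lemma hartogs_omega2 w1 w2 :
  holds (IsOmega1 w1) -> is_hartogs w1 w2 -> holds (IsOmega2 w2) /\ mem w1 w2.
Proof.
  intros H1 H; split.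
  - apply holds_IsOmega2; split; [apply (hartogs_ordinal H)|]; exists w1.
    split; auto; split; [apply (hartogs_not_inj H)|]; intros y Hy; now apply H in Hy.
  - apply H; split; [now apply holds_IsOmega1 in H1 | now apply inj_subset].
Qed.

Lemma omega1_unique x y : holds (IsOmega1 x) -> holds (IsOmega1 y) -> x = y.
Proof.
  intros (Ox & Nx & Cx)%holds_IsOmega1 (Oy & Ny & Cy)%holds_IsOmega1.
  destruct (ordinal_linear Ox Oy) as [H|[H|H]]; auto.
  - now destruct Nx; apply Cy.
  - now destruct Ny; apply Cx.
Qed.

Lemma omega1_inj_uncountable w a :
  holds (IsOmega1 w) -> ~ inj a omega -> inj w a.
Proof.
  intros (O & _ & C)%holds_IsOmega1 N.
  destruct (ordinal_or_inj a O) as [|(y & Hy & I)]; auto.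
  destruct N; apply (inj_trans I); auto.
Qed.

Lemma omega2_uncountable x : holds (IsOmega2 x) -> ~ inj x omega.
Proof.
  intros (O & w & H1 & N & _)%holds_IsOmega2 I; apply N; apply (inj_trans I).
  apply holds_IsOmega1 in H1 as (O1 & N1 & C1).
  destruct (ordinal_or_inj omega O1) as [I1|(y & Hy & I1)]; [easy|].
  apply (inj_trans I1), inj_subset, (proj1 O1), Hy.
Qed.

Lemma countable_lt_omega2 x a :
  holds (IsOmega2 x) -> inj a omega -> card_lt a x.
Proof.
  intros H C; pose proof (omega2_uncountable H) as N.
  apply holds_IsOmega2 in H as (O & _).
  split; rewrite holds_Injects.
  - destruct (ordinal_or_inj a O) as [I|(y & Hy & I)].
    + now destruct N; apply (inj_trans I).
    + apply (inj_trans I), inj_subset, (proj1 O), Hy.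
  - intros I; apply N, (inj_trans I C).
Qed.

Lemma lt_omega2_inj_omega1 x w a :
  holds (IsOmega2 x) -> holds (IsOmega1 w) -> card_lt a x -> inj a w.
Proof.
  intros (O & w' & H1 & N & C)%holds_IsOmega2 Hw [_ L].
  rewrite holds_Injects in L; rewrite (omega1_unique Hw H1).
  destruct (ordinal_or_inj a O) as [|(y & Hy & I)]; [easy|].
  apply (inj_trans I), C, Hy.
Qed.

(** * Regular cardinals *)

(** Closure under pairs makes [opair] itself an injection of the square of [A] into [A]; this
    replaces cardinal arithmetic in the proof of regularity. *)
Definition pair_closed A : Prop :=
  transitive A /\ forall x y, mem x A -> mem y A -> mem (opair x y) A.

Definition pair_step u : V :=
  union (upair u (union (upair (union u)
    (union (range u (fun x => range u (opair x))))))).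

Lemma mem_pair_step u z : mem z (pair_step u) <->
  mem z u \/ mem z (union u) \/ exists x y, mem x u /\ mem y u /\ z = opair x y.
Proof.
  unfold pair_step; rewrite mem_union; setoid_rewrite mem_upair.
  assert (E : mem z (union (range u (fun x => range u (opair x)))) <->
    exists x y, mem x u /\ mem y u /\ z = opair x y).
  { rewrite mem_union; setoid_rewrite mem_range; split.
    - intros (v & (x & Hx & ->) & Hz); apply mem_range in Hz as (y & Hy & ->); eauto 6.
    - intros (x & y & Hx & Hy & ->); exists (range u (opair x)); rewrite mem_range; eauto 6. }
  rewrite <- E; split.
  - intros (v & [-> | ->] & H); [auto|]; right.
    apply mem_union in H as (v & H & Hz); apply mem_upair in H as [-> | ->]; auto.
  - intros [H|H]; [eauto|]; eexists; split; [right; reflexivity|].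
    apply mem_union; setoid_rewrite mem_upair; destruct H; eauto.
Qed.

Lemma pair_closure a : exists A, pair_closed A /\ forall x, mem x a -> mem x A.
Proof.
  pose (U := nat_rect (fun _ => carrier V) a (fun _ => pair_step)).
  pose (A := union (seqset U)).
  assert (HA : forall x, mem x A <-> exists n, mem x (U n)).
  { intros x; unfold A; rewrite mem_union; setoid_rewrite mem_seqset; split.
    - intros (y & [n ->] & H); eauto.
    - intros [n H]; eauto. }
  assert (HS : forall n x, mem x (U n) -> mem x (U (S n))).
  { intros n x H; apply mem_pair_step; auto. }
  assert (HM : forall n k x, mem x (U n) -> mem x (U (k + n))).
  { intros n k x H; induction k; [easy | apply HS; easy]. }
  exists A; split; [split|].
  - intros y [n Hy]%HA z Hz; apply HA; exists (S n).
    apply mem_pair_step; right; left; apply mem_union; eauto.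
  - intros x y [n Hx]%HA [k Hy]%HA; apply HA; exists (S (k + n)).
    apply mem_pair_step; right; right; exists x, y; split; [auto|].
    split; [rewrite PeanoNat.Nat.add_comm; auto | easy].
  - intros x Hx; apply HA; now exists 0.
Qed.

(** A point of the union is coded by a pair: the code of an index whose piece contains it, and its
    code within that piece. *)
Lemma inj_union A x (F : V -> V) : pair_closed A ->
  inj x A -> (forall y, mem y x -> inj (F y) A) -> inj (union (range x F)) A.
Proof.
  intros [_ HA] (f & Hf & If) HF.
  destruct (choose (fun y (g : V -> V) => (forall z, mem z (F y) -> mem (g z) A) /\
    forall u v, mem u (F y) -> mem v (F y) -> g u = g v -> u = v) (fun z => z)) as [g Hg].
  destruct (choose (fun z y => mem y x /\ mem z (F y)) empty) as [i Hi].
  assert (Hu : forall z, mem z (union (range x F)) -> mem (i z) x /\ mem z (F (i z))).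
  { intros z (v & Hv & Hz)%mem_union; apply mem_range in Hv as (y & Hy & ->); eauto. }
  exists (fun z => opair (f (i z)) (g (i z) z)); split.
  - intros z [H1 H2]%Hu; apply HA; auto; now apply (Hg _ (HF _ H1)).
  - intros u v [H1 H2]%Hu [H3 H4]%Hu [E1 E2]%opair_inj.
    apply If in E1; auto; rewrite <- E1 in *.
    now apply (Hg _ (HF _ H1)).
Qed.

(** The new element [x] goes to [empty], and the old values are shifted to pairs with first
    coordinate [empty], none of which is empty. *)
Lemma hartogs_succ A theta x : pair_closed A -> mem empty A ->
  is_hartogs A theta -> mem x theta -> mem (succ x) theta.
Proof.
  intros [_ HA] He H Hx; apply H in Hx as [[Tx Ox] (f & Hf & If)]; apply H; split; [split|].
  - intros y [Hy| ->]%mem_succ z Hz; apply mem_succ; left; auto; apply (Tx y Hy z Hz).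
  - intros y [Hy| ->]%mem_succ; auto.
  - exists (fun z => if excluded_middle_informative (z = x) then empty
      else opair empty (f z)); split.
    + intros z Hz; destruct excluded_middle_informative; auto.
      apply mem_succ in Hz as [Hz|]; [auto | easy].
    + assert (N : forall y z, empty <> opair y z).
      { intros y z E; apply (@mem_empty (upair y y)); rewrite E; apply mem_upair; auto. }
      intros y z Hy Hz; apply mem_succ in Hy, Hz.
      do 2 destruct excluded_middle_informative; intros E; subst; try easy.
      * now destruct (N _ _ E).
      * now destruct (N _ _ (eq_sym E)).
      * apply opair_inj in E as [_ E]; destruct Hy, Hz; try easy; auto.
Qed.

(** The bound is the union of the successors of the values; successors make it strict. It is an
    ordinal that injects into [A] by [inj_union], hence lies in [theta]. *)
Lemma hartogs_regular A theta : pair_closed A -> mem empty A ->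
  is_hartogs A theta -> regular theta.
Proof.
  intros HA He H.
  assert (HS : forall x, mem x theta -> mem (succ x) theta).
  { intros x; now apply hartogs_succ with A. }
  split; [apply holds_Ordinal, (hartogs_ordinal H) | split].
  - intros w ->%holds_IsOmega; apply holds_Subset; intros z [n ->]%mem_omega.
    induction n as [|n IH]; cbn; auto.
    apply H; split; [split|].
    + intros y Hy; destruct (mem_empty Hy).
    + intros y Hy; destruct (mem_empty Hy).
    + exists (fun x => x); split; intros y; intros; destruct (@mem_empty y); auto.
  - intros a F Ha HF; exists (union (range a (fun x => succ (F x)))); split.
    + assert (HO : forall z, mem z (union (range a (fun x => succ (F x)))) ->
        exists x, mem x theta /\ mem z x /\
          forall u, mem u x -> mem u (union (range a (fun x => succ (F x))))).
      { intros z (v & Hv & Hz)%mem_union; exists v; split; [|split; auto].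
        - apply mem_range in Hv as (x & Hx & ->); auto.
        - intros u Hu; apply mem_union; eauto. }
      apply H; split; [split|].
      * intros y (x & Hx & Hy & Hs)%HO z Hz; apply Hs.
        apply H in Hx as [[Tx _] _]; apply (Tx y Hy z Hz).
      * intros y (x & Hx & Hy & _)%HO; apply H in Hx as [[_ Ox] _]; auto.
      * apply inj_union; auto; [now apply H in Ha | ].
        intros y Hy; apply H; auto.
    + intros x Hx; apply mem_union; exists (succ (F x)); split.
      * apply mem_range; eauto.
      * apply mem_succ; auto.
Qed.

Lemma H_hartogs A theta x : transitive A -> is_hartogs A theta ->
  (forall z, mem z x -> mem z A) -> H theta x.
Proof.
  intros TA HA Hx.
  (* The transitive closure is the intersection of the transitive supersets of [x], cut out of
     [A]. *)
  pose (t := sep (fun u => forall v, transitive v ->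
    (forall z, mem z x -> mem z v) -> mem u v) A).
  assert (Ht : inj t A) by (apply inj_subset; intros z Hz; now apply mem_sep in Hz).
  exists t; repeat split.
  - apply holds_Transitive; intros y Hy z Hz; apply mem_sep in Hy as [Hy Hv].
    apply mem_sep; split; [apply (TA y Hy z Hz)|].
    intros v Tv Hxv; apply (Tv y (Hv v Tv Hxv) z Hz).
  - apply holds_Subset; intros z Hz; apply mem_sep; auto.
  - intros u Tu Hu; rewrite holds_Transitive in Tu; rewrite holds_Subset in *.
    intros z Hz; apply mem_sep in Hz as [_ Hz]; auto.
  - apply holds_Injects, (inj_trans Ht), (inj_hartogs HA).
  - rewrite holds_Injects; intros I; apply (hartogs_not_inj HA), (inj_trans I Ht).
Qed.

(** [theta] is the Hartogs number of a transitive pair-closed [A] containing [a]. Sets are later put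
    into H_theta by checking that their elements lie in [A]. *)
Lemma large_regular a : exists A theta, transitive A /\ mem a A /\
  regular theta /\ (forall x, (forall z, mem z x -> mem z A) -> H theta x) /\
  forall x, mem x A -> ordinal x -> mem x theta.
Proof.
  destruct (pair_closure (upair a empty)) as (A & [TA PA] & HA).
  destruct (hartogs A) as [theta Ht].
  exists A, theta; split; [easy|].
  split; [apply HA, mem_upair; auto|]; split; [|split].
  - apply hartogs_regular with A; [easy | apply HA, mem_upair; auto | easy].
  - intros x; now apply H_hartogs.
  - intros x Hx Ox; apply Ht; split; auto; apply inj_subset, TA, Hx.
Qed.

End Sets.

Section Forces.
Context {V : universe} (P : forcing V).
Implicit Types p q r s t a b x y z u v w sigma tau pi rho : V.

(** * Conditions and induction on names *)

Lemma le_cond p q : le P p q -> mem p (cond P) /\ mem q (cond P).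
Proof.
  intros H; destruct (leq_cond H) as (p' & q' & Hp & Hq & [-> ->]%opair_inj); auto.
Qed.

Lemma le_refl_l p q : le P p q -> le P p p.
Proof. intros [H _]%le_cond; now apply leq_refl. Qed.

Lemma le_trans p q r : le P p q -> le P q r -> le P p r.
Proof. apply leq_trans. Qed.

Hint Resolve le_refl_l le_trans : forcing.

(** [pi] lies three membership steps below [sigma], through [upair pi pi] and [opair pi s], so the
    induction is along the transitive closure of membership. *)
Lemma name_ind (Q : V -> Prop) :
  (forall sigma, (forall pi s, name_mem P pi s sigma -> Q pi) -> Q sigma) ->
  forall sigma, Q sigma.
Proof.
  intros H sigma.
  induction sigma as [sigma IH]
    using (well_founded_ind (wf_clos_trans _ _ (foundation (u := V)))).
  apply H; intros pi s [Hs _]; apply IH.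
  apply t_trans with (upair pi pi); [|apply t_trans with (opair pi s)];
    apply t_step; try easy; unfold opair; rewrite mem_upair; auto.
Qed.

(** * Equality of names *)

Lemma forces_eq_inv p sigma tau : forces_eq P p sigma tau ->
  (forall pi s, name_mem P pi s sigma -> forall q, le P q p -> le P q s ->
     exists r, le P r q /\ exists rho t,
       name_mem P rho t tau /\ le P r t /\ forces_eq P r pi rho) /\
  (forall rho t, name_mem P rho t tau -> forall q, le P q p -> le P q t ->
     exists r, le P r q /\ exists pi s,
       name_mem P pi s sigma /\ le P r s /\ forces_eq P r pi rho).
Proof. now intros []. Qed.

Lemma forces_eq_refl p sigma : forces_eq P p sigma sigma.
Proof.
  revert p; induction sigma as [sigma IH] using name_ind; intros p.
  constructor; intros pi s Hs q Hp Hq; exists q; split; eauto 6 with forcing.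
Qed.

Lemma forces_eq_sym p sigma tau : forces_eq P p sigma tau -> forces_eq P p tau sigma.
Proof.
  revert p tau; induction sigma as [sigma IH] using name_ind.
  intros p tau [H1 H2]%forces_eq_inv; constructor.
  - intros rho t Ht q Hp Hq.
    destruct (H2 rho t Ht q Hp Hq) as (r & Hr & pi & s & Hs & Hrs & E); eauto 9.
  - intros pi s Hs q Hp Hq.
    destruct (H1 pi s Hs q Hp Hq) as (r & Hr & rho & t & Ht & Hrt & E); eauto 9.
Qed.

Lemma forces_eq_mono p q sigma tau :
  forces_eq P p sigma tau -> le P q p -> forces_eq P q sigma tau.
Proof.
  intros [H1 H2]%forces_eq_inv Hq; constructor; eauto with forcing.
Qed.

Lemma forces_eq_trans p sigma tau rho :
  forces_eq P p sigma tau -> forces_eq P p tau rho -> forces_eq P p sigma rho.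
Proof.
  revert p tau rho; induction sigma as [sigma IH] using name_ind.
  intros p tau rho [H1 H2]%forces_eq_inv [H3 H4]%forces_eq_inv; constructor.
  - intros pi s Hs q Hp Hq.
    destruct (H1 pi s Hs q Hp Hq) as (r & Hr & pi' & t & Ht & Hrt & E).
    destruct (H3 pi' t Ht r) as (r' & Hr' & pi2 & u & Hu & Hru & E'); eauto with forcing.
    exists r'; split; [eauto with forcing|]; exists pi2, u.
    split; [|split]; auto; eapply IH; eauto using forces_eq_mono.
  - intros pi s Hs q Hp Hq.
    destruct (H4 pi s Hs q Hp Hq) as (r & Hr & pi' & t & Ht & Hrt & E).
    destruct (H2 pi' t Ht r) as (r' & Hr' & pi2 & u & Hu & Hru & E'); eauto with forcing.
    exists r'; split; [eauto with forcing|]; exists pi2, u.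
    split; [|split]; auto; eapply IH; eauto using forces_eq_mono.
Qed.

(** * Monotonicity, density and the connectives *)

Lemma forces_mono f p q : forces P p f -> le P q p -> forces P q f.
Proof.
  revert p q; induction f as [x y|x y|x|f IHf|f IHf g IHg|f IHf]; cbn; intros p q H Hq.
  - intros r Hr; eauto with forcing.
  - eauto using forces_eq_mono.
  - intros r Hr; eauto with forcing.
  - intros r Hr; eauto with forcing.
  - destruct H; eauto.
  - eauto.
Qed.

(** Licenses passing to an extension that settles a case or supplies a witness before a formula is
    verified. *)
Lemma forces_density f p :
  (forall q, le P q p -> exists r, le P r q /\ forces P r f) -> forces P p f.
Proof.
  revert p; induction f as [x y|x y|x|f IHf|f IHf g IHg|f IHf]; cbn; intros p H.
  - intros q Hq; destruct (H q Hq) as (r & Hr & Hf).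
    destruct (Hf r) as (r' & Hr' & Hf'); eauto with forcing.
  - constructor; intros pi s Hs q Hp Hq; destruct (H q Hp) as (r & Hr & Hf);
      apply forces_eq_inv in Hf as [H1 H2].
    + destruct (H1 pi s Hs r) as (r' & Hr' & Hf'); eauto with forcing.
    + destruct (H2 pi s Hs r) as (r' & Hr' & Hf'); eauto with forcing.
  - intros q Hq; destruct (H q Hq) as (r & Hr & Hf).
    destruct (Hf r) as (r' & Hr' & Hf'); eauto with forcing.
  - intros q Hq Hf; destruct (H q Hq) as (r & Hr & N).
    apply (N r); eauto using forces_mono with forcing.
  - split; [apply IHf | apply IHg]; intros q Hq;
      destruct (H q Hq) as (r & Hr & H1 & H2); eauto.
  - intros sigma; apply IHf; intros q Hq; destruct (H q Hq) as (r & Hr & Hf); eauto.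
Qed.

Lemma forces_Not_elim f p : ~ forces P p (Not f) -> exists q, le P q p /\ forces P q f.
Proof. intros H; apply NNPP; intros N; apply H; intros q Hq Hf; apply N; eauto. Qed.

(** Unfolding [Imp] yields only that no extension forces both [f] and [Not g]; density removes the
    double negation on [g]. *)
Lemma forces_Imp f g p :
  forces P p (Imp f g) <-> forall q, le P q p -> forces P q f -> forces P q g.
Proof.
  unfold Imp, Ex, Or; cbn [forces]; split.
  - intros H q Hq Hf; apply forces_density; intros r Hr; apply NNPP; intros N.
    apply (H r); [eauto with forcing|]; split; [eauto using forces_mono|].
    intros r' Hr' Hg; apply N; eauto.
  - intros H q Hq [Hf N]; apply (N q); [eauto with forcing|]; now apply H.
Qed.

Lemma forces_Ex (f : V -> fm V) p : forces P p (Ex f) <->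
  forall q, le P q p -> exists r, le P r q /\ exists sigma, forces P r (f sigma).
Proof.
  unfold Imp, Ex, Or; cbn [forces]; split.
  - intros H q Hq; apply NNPP; intros N; apply (H q Hq); intros sigma r Hr Hf.
    apply N; eauto.
  - intros H q Hq N; destruct (H q Hq) as (r & Hr & sigma & Hf).
    apply (N sigma r Hr Hf).
Qed.

Lemma forces_Or f g p : forces P p (Or f g) <->
  forall q, le P q p -> exists r, le P r q /\ (forces P r f \/ forces P r g).
Proof.
  unfold Imp, Ex, Or; cbn [forces]; split.
  - intros H q Hq; apply NNPP; intros N; apply (H q Hq); split;
      intros r Hr Hf; apply N; eauto.
  - intros H q Hq [N1 N2]; destruct (H q Hq) as (r & Hr & [Hf|Hf]).
    + apply (N1 r Hr Hf).
    + apply (N2 r Hr Hf).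
Qed.

Lemma forces_Iff f g p : forces P p (Iff f g) <->
  forall q, le P q p -> (forces P q f <-> forces P q g).
Proof.
  unfold Iff; change (forces P p (Imp f g) /\ forces P p (Imp g f) <->
    forall q, le P q p -> (forces P q f <-> forces P q g)).
  rewrite !forces_Imp; firstorder.
Qed.

Lemma forces_All (f : V -> fm V) p :
  forces P p (All f) <-> forall sigma, forces P p (f sigma).
Proof. reflexivity. Qed.

Lemma forces_AllIn a (f : V -> fm V) p : forces P p (AllIn a f) <->
  forall sigma q, le P q p -> forces P q (Mem sigma a) -> forces P q (f sigma).
Proof.
  change (forces P p (AllIn a f)) with
    (forall sigma, forces P p (Imp (Mem sigma a) (f sigma))).
  setoid_rewrite forces_Imp; reflexivity.
Qed.

Lemma forces_ExIn a (f : V -> fm V) p : forces P p (ExIn a f) <->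
  forall q, le P q p -> exists r, le P r q /\ exists sigma,
    forces P r (Mem sigma a) /\ forces P r (f sigma).
Proof. unfold ExIn; rewrite forces_Ex; reflexivity. Qed.

Lemma forces_Ex_intro (f : V -> fm V) p sigma :
  forces P p (f sigma) -> forces P p (Ex f).
Proof.
  intros H; apply forces_Ex; intros q Hq; exists q; split; [eauto with forcing|].
  exists sigma; apply (forces_mono H Hq).
Qed.

Lemma forces_ExIn_intro a (f : V -> fm V) p sigma :
  forces P p (Mem sigma a) -> forces P p (f sigma) -> forces P p (ExIn a f).
Proof. intros H1 H2; apply forces_Ex_intro with sigma; now split. Qed.

(** * Substitution of equal names *)

(** In higher-order abstract syntax a function [V -> fm V] may inspect the name
    itself, so invariance under forced equality has to be stated. *)
Definition congruent (F : V -> fm V) : Prop := forall p sigma tau,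
  forces_eq P p sigma tau -> forces P p (F sigma) -> forces P p (F tau).

Lemma congruent_const f : congruent (fun _ => f).
Proof. now intros p. Qed.

Lemma congruent_Mem_l a : congruent (fun x => Mem x a).
Proof.
  intros p sigma tau E H q Hq; destruct (H q Hq) as (r & Hr & pi & s & Hs & Hrs & E').
  exists r; split; auto; exists pi, s; split; [|split]; auto.
  eauto using forces_eq_trans, forces_eq_sym, forces_eq_mono with forcing.
Qed.

Lemma congruent_Mem_r a : congruent (fun x => Mem a x).
Proof.
  intros p sigma tau E H q Hq; destruct (H q Hq) as (r & Hr & pi & s & Hs & Hrs & E').
  apply forces_eq_inv in E as [E _].
  destruct (E pi s Hs r) as (r' & Hr' & rho & t & Ht & Hrt & E2); eauto with forcing.
  exists r'; split; [eauto with forcing|]; exists rho, t; split; [|split]; auto.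
  eauto using forces_eq_trans, forces_eq_mono.
Qed.

Lemma congruent_Eq_l a : congruent (fun x => Eq x a).
Proof. intros p sigma tau E H; cbn in *; eauto using forces_eq_trans, forces_eq_sym. Qed.

Lemma congruent_Eq_r a : congruent (fun x => Eq a x).
Proof. intros p sigma tau E H; cbn in *; eauto using forces_eq_trans, forces_eq_sym. Qed.

Lemma congruent_Not F : congruent F -> congruent (fun x => Not (F x)).
Proof.
  intros HF p sigma tau E H q Hq Hf; apply (H q Hq).
  apply (HF q tau); auto; eauto using forces_eq_sym, forces_eq_mono.
Qed.

Lemma congruent_And F G : congruent F -> congruent G -> congruent (fun x => And (F x) (G x)).
Proof. intros HF HG p sigma tau E [H1 H2]; split; eauto. Qed.

Lemma congruent_All (F : V -> V -> fm V) :
  (forall y, congruent (fun x => F x y)) -> congruent (fun x => All (F x)).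
Proof. intros HF p sigma tau E H rho; exact (HF rho _ _ _ E (H rho)). Qed.

Ltac solve_congruent := unfold Countable, Injects, IsInjection, IsInter, Subset, IsUpair,
    AllIn, ExIn, Iff, Or, Imp, Ex;
  repeat first [ apply congruent_const | apply congruent_Mem_l | apply congruent_Mem_r
    | apply congruent_Eq_l | apply congruent_Eq_r | apply congruent_Not
    | apply congruent_And | apply congruent_All; intro ].

Lemma congruent_Countable : congruent (fun x => Countable x).
Proof. solve_congruent. Qed.

Lemma congruent_IsInter b c : congruent (fun x => IsInter b x c).
Proof. solve_congruent. Qed.

Lemma congruent_IsInter_l b c : congruent (fun x => IsInter x b c).
Proof. solve_congruent. Qed.

Lemma congruent_Subset_r b : congruent (fun x => Subset b x).
Proof. solve_congruent. Qed.

(** It is enough to test the names occurring in [sigma] or [tau]: below its attached condition such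
    a name is forced into the name listing it, and the hypothesis carries it to the other. *)
Lemma forces_ext p sigma tau :
  (forall rho, forces P p (Iff (Mem rho sigma) (Mem rho tau))) -> forces_eq P p sigma tau.
Proof.
  intros H; constructor; intros pi s Hs q Hp Hq; specialize (H pi);
    rewrite forces_Iff in H; specialize (H q Hp); cbn in H.
  - apply H; [|eauto with forcing]; intros r Hr; exists r; split; [eauto with forcing|].
    exists pi, s; eauto using forces_eq_refl with forcing.
  - destruct H as [_ H]; destruct (fun K => H K q) as (r & Hr & rho & t & Ht & Hrt & E).
    + intros r Hr; exists r; split; [eauto with forcing|].
      exists pi, s; eauto using forces_eq_refl with forcing.
    + eauto with forcing.
    + exists r; split; auto; exists rho, t; eauto using forces_eq_sym.
Qed.

(** * Canonical names *)

Lemma name_mem_check pi s x :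
  name_mem P pi s (check P x) <-> (exists y, mem y x /\ pi = check P y) /\ mem s (cond P).
Proof.
  unfold name_mem; rewrite mem_check; split.
  - intros [(y & p & Hy & Hp & [-> ->]%opair_inj) Hs]; eauto.
  - intros [(y & Hy & ->) Hs]; eauto 8.
Qed.

Lemma forces_Mem_check p sigma x : forces P p (Mem sigma (check P x)) <->
  forall q, le P q p -> exists r, le P r q /\ exists y,
    mem y x /\ forces_eq P r sigma (check P y).
Proof.
  cbn; split; intros H q Hq.
  - destruct (H q Hq) as (r & Hr & pi & s & Hs & Hrs & E).
    apply name_mem_check in Hs as [(y & Hy & ->) _]; eauto.
  - destruct (H q Hq) as (r & Hr & y & Hy & E).
    exists r; split; auto; exists (check P y), r.
    rewrite name_mem_check; split; [|eauto with forcing].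
    split; [eauto | apply (le_cond Hr)].
Qed.

Lemma forces_check_mem p x y : mem x y -> forces P p (Mem (check P x) (check P y)).
Proof.
  intros H; apply forces_Mem_check; intros q Hq.
  exists q; split; eauto using forces_eq_refl with forcing.
Qed.

(** Membership induction. [p] has to be a condition, since anything else has nothing below it and
    forces every equation. *)
Lemma forces_eq_check p x y : mem p (cond P) -> forces_eq P p (check P x) (check P y) -> x = y.
Proof.
  revert p y; induction x as [x IH] using (well_founded_ind (foundation (u := V))).
  intros p y Hp E; assert (Lp : le P p p) by now apply leq_refl.
  apply extensionality; intros z; split; intros Hz.
  - assert (H : forces P p (Mem (check P z) (check P y))).
    { apply (congruent_Mem_r E), forces_check_mem, Hz. }
    rewrite forces_Mem_check in H; destruct (H p Lp) as (r & Hr & u & Hu & E').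
    rewrite (IH z Hz r u); auto; apply (le_cond Hr).
  - assert (H : forces P p (Mem (check P z) (check P x))).
    { apply (congruent_Mem_r (forces_eq_sym E)), forces_check_mem, Hz. }
    rewrite forces_Mem_check in H; destruct (H p Lp) as (r & Hr & u & Hu & E').
    rewrite <- (IH u Hu r z); auto; [apply (le_cond Hr) | now apply forces_eq_sym].
Qed.

Lemma forces_check_mem_inv p x y :
  mem p (cond P) -> forces P p (Mem (check P x) (check P y)) -> mem x y.
Proof.
  intros Hp H; rewrite forces_Mem_check in H.
  destruct (H p (leq_refl Hp)) as (r & Hr & u & Hu & E).
  rewrite (@forces_eq_check r x u); auto; apply (le_cond Hr).
Qed.

(** * Names for pairs *)

(** With no greatest condition at hand, each component is attached to all conditions. *)
Definition upname sigma tau : V :=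
  union (upair (range (cond P) (opair sigma)) (range (cond P) (opair tau))).
Definition opname sigma tau : V := upname (upname sigma sigma) (upname sigma tau).

Lemma name_mem_upname pi s sigma tau : name_mem P pi s (upname sigma tau) <->
  (pi = sigma \/ pi = tau) /\ mem s (cond P).
Proof.
  unfold name_mem, upname; rewrite mem_union; setoid_rewrite mem_upair; split.
  - intros [(y & [-> | ->] & Hy) Hs]; apply mem_range in Hy as (p & Hp & [-> ->]%opair_inj);
      auto.
  - intros [H Hs]; split; auto.
    exists (range (cond P) (opair pi)); rewrite mem_range; split; eauto.
    destruct H as [-> | ->]; auto.
Qed.

Lemma forces_Mem_upname p pi sigma tau : forces P p (Mem pi (upname sigma tau)) <->
  forces P p (Or (Eq pi sigma) (Eq pi tau)).
Proof.
  rewrite forces_Or; cbn; split; intros H q Hq.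
  - destruct (H q Hq) as (r & Hr & rho & s & Hs & Hrs & E).
    apply name_mem_upname in Hs as [[-> | ->] _]; eauto.
  - destruct (H q Hq) as (r & Hr & E).
    exists r; split; auto.
    destruct E as [E|E]; [exists sigma, r | exists tau, r];
      (split; [apply name_mem_upname; split; [auto | apply (le_cond Hr)]|]);
      eauto with forcing.
Qed.

Lemma forces_IsUpair p pi sigma tau :
  forces P p (IsUpair pi sigma tau) <-> forces_eq P p pi (upname sigma tau).
Proof.
  split.
  - intros H; apply forces_ext; intros rho; specialize (H rho).
    rewrite forces_Iff in *; setoid_rewrite forces_Mem_upname; exact H.
  - intros E rho; apply forces_Iff; intros q Hq; rewrite <- forces_Mem_upname.
    apply forces_eq_mono with (q := q) in E; auto.
    split; apply congruent_Mem_r; auto using forces_eq_sym.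
Qed.

Lemma upname_congr p a b c d : forces_eq P p a c -> forces_eq P p b d ->
  forces_eq P p (upname a b) (upname c d).
Proof.
  intros E1 E2; apply forces_IsUpair.
  assert (C1 : congruent (fun x => IsUpair (upname a b) x b)) by solve_congruent.
  assert (C2 : congruent (fun x => IsUpair (upname a b) c x)) by solve_congruent.
  apply (C2 p _ _ E2), (C1 p _ _ E1), forces_IsUpair, forces_eq_refl.
Qed.

Lemma opname_congr p a b c d : forces_eq P p a c -> forces_eq P p b d ->
  forces_eq P p (opname a b) (opname c d).
Proof. intros; repeat apply upname_congr; auto. Qed.

(** Which matching holds may depend on the generic, so it is only decided densely: four successive
    extensions fix partners for [a], [b], [c], [d]. *)
Lemma upname_inj p a b c d : forces_eq P p (upname a b) (upname c d) ->
  forall q, le P q p -> exists r, le P r q /\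
    ((forces_eq P r a c /\ forces_eq P r b d) \/ (forces_eq P r a d /\ forces_eq P r b c)).
Proof.
  intros E q Hq.
  assert (M : forall x y z, z = x \/ z = y -> forces P p (Mem z (upname x y))).
  { intros x y z H; apply forces_Mem_upname, forces_Or; intros r Hr.
    exists r; split; [eauto with forcing|].
    destruct H as [-> | ->]; [left | right]; apply forces_eq_refl. }
  assert (L : forall z, z = a \/ z = b -> forces P p (Or (Eq z c) (Eq z d))).
  { intros z Hz; apply forces_Mem_upname, (congruent_Mem_r E); auto. }
  assert (R : forall z, z = c \/ z = d -> forces P p (Or (Eq z a) (Eq z b))).
  { intros z Hz; apply forces_Mem_upname, (congruent_Mem_r (forces_eq_sym E)); auto. }
  setoid_rewrite forces_Or in L; setoid_rewrite forces_Or in R; cbn in L, R.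
  destruct (L a (or_introl eq_refl) q Hq) as (q1 & H1 & E1).
  destruct (L b (or_intror eq_refl) q1) as (q2 & H2 & E2); [eauto with forcing|].
  destruct (R c (or_introl eq_refl) q2) as (q3 & H3 & E3); [eauto with forcing|].
  destruct (R d (or_intror eq_refl) q3) as (r & Hr & E4); [eauto with forcing|].
  exists r; split; [eauto with forcing|].
  assert (E1' : forces_eq P r a c \/ forces_eq P r a d).
  { destruct E1; [left|right]; eauto using forces_eq_mono with forcing. }
  assert (E2' : forces_eq P r b c \/ forces_eq P r b d).
  { destruct E2; [left|right]; eauto using forces_eq_mono with forcing. }
  assert (E3' : forces_eq P r c a \/ forces_eq P r c b).
  { destruct E3; [left|right]; eauto using forces_eq_mono with forcing. }
  destruct E1', E2', E3', E4; (left; split;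
    solve [eauto 4 using forces_eq_trans, forces_eq_sym]) || (right; split;
    solve [eauto 4 using forces_eq_trans, forces_eq_sym]).
Qed.

(** All cases of [upname_inj] lead to the same two equations, so density brings them back to [p]
    itself. *)
Lemma opname_inj p a b c d : forces_eq P p (opname a b) (opname c d) ->
  forces_eq P p a c /\ forces_eq P p b d.
Proof.
  intros E.
  assert (forces P p (And (Eq a c) (Eq b d))) as [? ?]; [|now split].
  apply forces_density; intros q Hq.
  destruct (upname_inj E Hq) as (r & Hr & [[E1 E2]|[E1 E2]]);
    destruct (upname_inj E1 (q := r)) as (r1 & Hr1 & E1'); eauto with forcing;
    destruct (upname_inj E2 (q := r1)) as (r2 & Hr2 & E2'); eauto with forcing;
    (exists r2; split; [eauto with forcing|]).
  - assert (E3 : forces_eq P r2 a c).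
    { destruct E1' as [[]|[]]; eauto using forces_eq_mono with forcing. }
    split; [easy|]; cbn; destruct E2' as [[]|[]];
      eauto 4 using forces_eq_trans, forces_eq_sym.
  - assert (E3 : forces_eq P r2 a c).
    { destruct E1' as [[]|[]]; eauto using forces_eq_mono with forcing. }
    assert (E4 : forces_eq P r2 a d).
    { destruct E1' as [[]|[]]; eauto using forces_eq_mono with forcing. }
    split; [easy|]; cbn; destruct E2' as [[]|[]];
      eauto 4 using forces_eq_trans, forces_eq_sym.
Qed.

Lemma forces_IsOpair p pi sigma tau :
  forces P p (IsOpair pi sigma tau) <-> forces_eq P p pi (opname sigma tau).
Proof.
  split.
  - intros H; change (forces P p (Eq pi (opname sigma tau))).
    apply forces_density; intros q Hq; unfold IsOpair in H; rewrite forces_Ex in H.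
    destruct (H q Hq) as (r & Hr & u & Hu); rewrite forces_Ex in Hu.
    destruct (Hu r) as (r' & Hr' & v & H1 & H2 & H3); [eauto with forcing|].
    rewrite forces_IsUpair in H1, H2, H3; exists r'; split; [eauto with forcing|].
    eapply forces_eq_trans; [eauto|]; now apply upname_congr.
  - intros E; apply forces_Ex_intro with (upname sigma sigma).
    apply forces_Ex_intro with (upname sigma tau).
    split; [|split]; apply forces_IsUpair; auto using forces_eq_refl.
Qed.

Lemma forces_MapsTo p f sigma tau :
  forces P p (MapsTo f sigma tau) <-> forces P p (Mem (opname sigma tau) f).
Proof.
  split.
  - intros H; apply forces_density; intros q Hq.
    unfold MapsTo in H; rewrite forces_ExIn in H.
    destruct (H q Hq) as (r & Hr & pi & H1 & H2); rewrite forces_IsOpair in H2.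
    exists r; split; auto; apply (congruent_Mem_l H2 H1).
  - intros H; apply forces_ExIn_intro with (opname sigma tau); auto.
    apply forces_IsOpair, forces_eq_refl.
Qed.

(** * Countability *)

(** A forced injection [check a -> w] composed with an injection [w1 -> a] of V
    would make [w1] countable in the extension. *)
Lemma forces_Countable_check p a : preserves_omega1 P -> mem p (cond P) ->
  forces P p (Countable (check P a)) -> inj a omega.
Proof.
  intros HP Hp HC; apply NNPP; intros N.
  destruct (hartogs (V := V) omega) as [w1 Hw1]; apply hartogs_omega1 in Hw1.
  destruct (omega1_inj_uncountable Hw1 N) as (h & Hh & Ih).
  destruct (HP w1 Hw1 p Hp) as (_ & NC & _).
  unfold Countable in HC; rewrite forces_Ex in HC.
  destruct (HC p (leq_refl Hp)) as (r0 & Hr0 & w & Hw & HI).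
  unfold Injects in HI; rewrite forces_Ex in HI.
  destruct (HI r0) as (p' & Hp' & g & _ & Gt & Gi); [eauto with forcing|].
  clear HI HC.
  (* [k] will name the composition of [h] with [g]: the pair of [check P x] and a name [rho] listed
     in [w] is attached to conditions forcing [g] to send [h x] to [rho]. *)
  pose (Q z := exists x rho s t, mem x w1 /\ name_mem P rho t w /\ le P s t /\
    forces P s (Mem (opname (check P (h x)) rho) g) /\
    z = opair (opname (check P x) rho) s).
  (* The bounding set works because [rho] lies in [upair rho rho], an element of [opair rho t],
     hence in the double union of [w]. *)
  pose (k := sep Q (union (range w1 (fun x => union (range (union (union w))
    (fun rho => range (cond P) (opair (opname (check P x) rho)))))))).
  assert (Hk : forall z, mem z k <-> Q z).
  { intros z; unfold k; rewrite mem_sep; split; [tauto|]; intros HQ; split; auto.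
    destruct HQ as (x & rho & s & t & Hx & [Ht _] & Hst & _ & ->).
    apply mem_union; eexists; split; [apply mem_range; eauto|].
    apply mem_union; eexists; split; [apply mem_range|].
    - exists rho; split; [|reflexivity]; apply mem_union; exists (upair rho rho).
      split; [|apply mem_upair; auto]; apply mem_union; exists (opair rho t).
      split; auto; unfold opair; apply mem_upair; auto.
    - apply mem_range; exists s; split; auto; apply (le_cond Hst). }
  assert (Kin : forall q sigma, forces P q (Mem sigma k) -> forall q', le P q' q ->
    exists r, le P r q' /\ exists x rho, mem x w1 /\ forces P r (Mem rho w) /\
      forces P r (Mem (opname (check P (h x)) rho) g) /\
      forces_eq P r sigma (opname (check P x) rho)).
  { intros q sigma H q' Hq'; destruct (H q' Hq') as (r & Hr & pi & s & [Hs _] & Hrs & E).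
    apply Hk in Hs as (x & rho & s' & t & Hx & Ht & Hst & Hg & [-> ->]%opair_inj).
    exists r; split; auto; exists x, rho; split; [easy|]; split; [|split; auto].
    - intros r' Hr'; exists r'; split; [eauto with forcing|].
      exists rho, t; eauto using forces_eq_refl with forcing.
    - eauto using forces_mono. }
  assert (Kmap : forall q x y, forces P q (Mem (opname x y) k) -> forall q', le P q' q ->
    exists r, le P r q' /\ exists x0, mem x0 w1 /\ forces_eq P r x (check P x0) /\
      forces P r (Mem (opname (check P (h x0)) y) g)).
  { intros q x y H q' Hq'.
    destruct (Kin q _ H q' Hq') as (r & Hr & x0 & rho & Hx & _ & Hg & E).
    apply opname_inj in E as [E1 E2].
    exists r; split; auto; exists x0; split; [|split]; auto.
    apply (congruent_Mem_l (opname_congr (forces_eq_refl _ _) (forces_eq_sym E2))), Hg. }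
  rewrite forces_AllIn in Gt.
  assert (Ginj : forall q a b c d, le P q p' ->
    forces P q (Mem (opname a b) g) -> forces P q (Mem (opname c d) g) ->
    (forces_eq P q a c <-> forces_eq P q b d)).
  { intros q b c d e Hq H1 H2; specialize (Gi b c d e).
    rewrite forces_Imp in Gi.
    specialize (Gi q Hq (conj (proj2 (forces_MapsTo _ _ _ _) H1)
      (proj2 (forces_MapsTo _ _ _ _) H2))).
    rewrite forces_Iff in Gi; apply Gi; eauto with forcing. }
  apply (NC p'); [eauto with forcing|].
  apply forces_Ex_intro with w; split; [apply (forces_mono Hw Hp')|].
  apply forces_Ex_intro with k; split; [|split].
  - apply forces_AllIn; intros sigma q Hq H; apply forces_density; intros q' Hq'.
    destruct (Kin q sigma H q' Hq') as (r & Hr & x & rho & Hx & Hrho & _ & E).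
    exists r; split; auto.
    apply forces_ExIn_intro with (check P x); [now apply forces_check_mem|].
    apply forces_ExIn_intro with rho; [easy|]; now apply forces_IsOpair.
  (* Totality: [g] sends [h x] to some [y] in [w], which an extension identifies with a name [rho]
     listed in [w]; the resulting pair is in [k]. *)
  - apply forces_AllIn; intros sigma q Hq H; apply forces_density; intros q' Hq'.
    rewrite forces_Mem_check in H; destruct (H q' Hq') as (r & Hr & x & Hx & E).
    assert (Hrp : le P r p') by eauto with forcing.
    specialize (Gt (check P (h x)) r Hrp (forces_check_mem (Hh x Hx))).
    rewrite forces_ExIn in Gt.
    destruct (Gt r) as (r1 & Hr1 & y & Hy & Hg); [eauto with forcing|].
    apply forces_MapsTo in Hg.
    destruct (Hy r1) as (r2 & Hr2 & rho & t & Ht & Hrt & E2); [eauto with forcing|].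
    exists r2; split; [eauto with forcing|].
    apply forces_ExIn_intro with rho.
    + intros r' Hr'; exists r'; split; [eauto with forcing|].
      exists rho, t; eauto using forces_eq_refl with forcing.
    + apply forces_MapsTo; intros r' Hr'; exists r'; split; [eauto with forcing|].
      exists (opname (check P x) rho), r2; split; [split|split].
      * apply Hk; exists x, rho, r2, t; do 3 (split; [easy|]); split; [|easy].
        apply (congruent_Mem_l (opname_congr (forces_eq_refl _ _) E2)).
        apply (forces_mono Hg Hr2).
      * apply (le_cond Hr2).
      * easy.
      * apply opname_congr; [|apply forces_eq_refl].
        apply forces_eq_mono with r; eauto with forcing.
  - intros x y u v; apply forces_Imp; intros q Hq [H1 H2].
    rewrite forces_MapsTo in H1, H2.
    (* Densely both arguments are ground elements [x0] and [u0]. The equivalence then follows from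
       that for [g], injectivity of [h] in V, and absoluteness of equality between check names. *)
    assert (D : forall q', le P q' q -> exists r, le P r q' /\
      exists x0 u0, mem x0 w1 /\ mem u0 w1 /\
      forces_eq P r x (check P x0) /\ forces_eq P r u (check P u0) /\
      forces P r (Mem (opname (check P (h x0)) y) g) /\
      forces P r (Mem (opname (check P (h u0)) v) g)).
    { intros q' Hq'; destruct (Kmap q x y H1 q' Hq') as (r & Hr & x0 & Hx & E & G).
      destruct (Kmap q u v H2 r) as (r' & Hr' & u0 & Hu & E' & G'); [eauto with forcing|].
      exists r'; split; [eauto with forcing|]; exists x0, u0.
      repeat (split; [eauto using forces_eq_mono, forces_mono|]); auto. }
    apply forces_Iff; intros q' Hq'; split; intros E; apply forces_density;
      intros q2 Hq2; (destruct (D q2) as (r & Hr & x0 & u0 & Hx & Hu & E1 & E2 & G1 & G2);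
      [eauto with forcing|]); exists r; (split; [auto|]);
      apply (@forces_mono _ _ r) in E; [|eauto with forcing| |eauto with forcing];
      specialize (Ginj r _ _ _ _ ltac:(eauto with forcing) G1 G2).
    + apply Ginj; rewrite (@forces_eq_check r x0 u0);
        [apply forces_eq_refl | apply (le_cond Hr) |].
      eauto using forces_eq_trans, forces_eq_sym.
    + apply Ginj, forces_eq_check, Ih in E; auto; [|apply (le_cond Hr)].
      subst u0; eapply forces_eq_trans; eauto using forces_eq_sym.
Qed.
End Forces.

(** * Conditions deciding a name *)

Section Deciding.
Context {V : universe} (P : forcing V).
Implicit Types a q r s t u y z sigma : V.

(** Genericity speaks of sets dense in all of [P], so the conditions incompatible with [q] are
    added; compatibility with a condition below [q] excludes them later. *)
Definition inter_deciders sigma q a : V :=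
  sep (fun r => (exists b, forces P r (IsInter (check P b) (check P a) sigma)) \/
    ~ compatible P r q) (cond P).

Definition differs_at sigma y u r z : Prop :=
  mem z y /\
  ((~ mem z u /\ forces P r (Mem (check P z) sigma)) \/
   (mem z u /\ forces P r (Not (Mem (check P z) sigma)))).

(** The separated set is the intersection of [u] and [y], so the first alternative already makes
    [sigma] a ground set. *)
Definition eq_deciders sigma q y u : V :=
  sep (fun r => forces_eq P r sigma (check P (sep (fun z => mem z u) y)) \/
    (exists z, differs_at sigma y u r z) \/ ~ compatible P r q) (cond P).

Lemma dense_below (Q : V -> Prop) q :
  (forall s t, le P t s -> le P t q -> exists r, le P r t /\ Q r) ->
  (forall r, ~ compatible P r q -> Q r) -> dense P (sep Q (cond P)).
Proof.
  intros HQ HN; split; [intros s Hs; apply mem_sep in Hs; tauto|]; intros s Hs.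
  destruct (classic (compatible P s q)) as [(t & Hts & Htq)|N].
  - destruct (HQ s t Hts Htq) as (r & Hr & Qr); exists r; split.
    + apply mem_sep; split; [apply (le_cond Hr) | easy].
    + apply (le_trans Hr Hts).
  - exists s; split; [apply mem_sep; auto | now apply leq_refl].
Qed.

Lemma inter_deciders_dense sigma q a :
  forces P q (InterInGround (check P a) sigma) -> dense P (inter_deciders sigma q a).
Proof.
  intros HA; apply dense_below with q; [|auto]; intros s t _ Ht.
  unfold InterInGround in HA; rewrite forces_Ex in HA.
  destruct (HA t Ht) as (t1 & Ht1 & rho & Grho & Irho).
  destruct (Grho t1 (le_refl_l Ht1)) as (t2 & Ht2 & c & Ec).
  exists t2; split; [apply (le_trans Ht2 Ht1)|]; left; exists c.
  apply (congruent_IsInter_l Ec), (forces_mono Irho Ht2).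
Qed.

(** If no extension of [t] decides a disagreement, [t] forces equality: an element of [sigma] is
    densely some [z] in [y], which must lie in [u], and no extension can force an element of the
    intersection out of [sigma]. *)
Lemma eq_deciders_dense sigma q y u :
  forces P q (Subset sigma (check P y)) -> dense P (eq_deciders sigma q y u).
Proof.
  intros Hy; apply dense_below with q; [|auto]; intros s t _ Htq.
  apply NNPP; intros ND.
  assert (N1 : forall t' z, le P t' t -> ~ differs_at sigma y u t' z).
  { intros t' z Ht' Hd; apply ND; exists t'; eauto. }
  apply ND; exists t; split; [apply (le_refl_l Htq)|]; left.
  apply forces_ext; intros rho; apply forces_Iff; intros t1 Ht1.
  assert (Lt1 : le P t1 q) by apply (le_trans Ht1 Htq).
  split; intros Hin; apply forces_density; intros t2 Ht2.
  - assert (Hin' : forces P t2 (Mem rho (check P y))).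
    { apply (proj1 (forces_AllIn _ _ _ _) Hy); [apply (le_trans Ht2 Lt1)|].
      apply (forces_mono Hin Ht2). }
    rewrite forces_Mem_check in Hin'.
    destruct (Hin' t2 (le_refl_l Ht2)) as (t3 & Ht3 & z & Hz & Ez).
    exists t3; split; auto; apply (congruent_Mem_l (forces_eq_sym Ez)), forces_check_mem.
    apply mem_sep; split; auto; apply NNPP; intros Nz.
    apply (N1 t3 z); [apply (le_trans Ht3 (le_trans Ht2 Ht1))|].
    split; auto; left; split; auto; apply (congruent_Mem_l Ez).
    apply (forces_mono Hin), (le_trans Ht3 Ht2).
  - rewrite forces_Mem_check in Hin.
    destruct (Hin t2 Ht2) as (t3 & Ht3 & z & Hz & Ez); apply mem_sep in Hz as [Hzy Hzu].
    assert (NN : ~ forces P t3 (Not (Mem (check P z) sigma))).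
    { intros N; apply (N1 t3 z); [apply (le_trans Ht3 (le_trans Ht2 Ht1))|].
      split; auto. }
    apply forces_Not_elim in NN as (t4 & Ht4 & H4).
    exists t4; split; [apply (le_trans Ht4 Ht3)|].
    apply (congruent_Mem_l (forces_eq_sym (forces_eq_mono Ez Ht4)) H4).
Qed.
End Deciding.

(** * Guessing models and the approximation property *)

Lemma opair_in_transitive (V : universe) (A x y : V) :
  transitive A -> mem (opair x y) A -> mem x A /\ mem y A.
Proof.
  intros TA H.
  assert (H' : mem (upair x y) A).
  { apply (TA _ H); unfold opair; apply mem_upair; auto. }
  split; apply (TA _ H'), mem_upair; auto.
Qed.

(** [F] only receives the unordered pair of the arguments, so it collects the
    values for both orders. *)
Lemma stationary_closed (V : universe) (theta w2 : V) (S : V -> Prop)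
    (vals : V -> V -> list V) :
  stationary theta S -> holds (IsOmega2 w2) -> (exists A : V, H theta A) ->
  exists m, in_Pomega2 (H theta) m /\ S m /\ elementary m (H theta) /\
    (exists a, mem a w2 /\ forall x, mem x a <-> mem x m /\ mem x w2) /\
    forall x y v, mem x m -> mem y m -> In v (vals x y) -> H theta v -> mem v m.
Proof.
  intros HS Hw2 [d Hd].
  (* Values outside H_theta are replaced by [d], which also pads the finite list to a sequence; so
     [F] yields countable subsets of H_theta. *)
  pose (gd v := if excluded_middle_informative (H theta v) then v else d).
  assert (Hgd : forall v, H theta (gd v)).
  { intros v; unfold gd; now destruct excluded_middle_informative. }
  destruct (choose (fun e (c : V * V) => e = upair (fst c) (snd c)) (d, d)) as [c Hc].
  pose (F e := let (x, y) := c e in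
    seqset (fun n => gd (nth n (vals x y ++ vals y x) d))).
  destruct (HS F) as (m & Hm & Sm & Em & Hi & Cm).
  { intros e _; unfold F; destruct (c e) as [x y]; split.
    - intros z [n ->]%mem_seqset; apply Hgd.
    - intros w Hw; apply countable_lt_omega2; auto using inj_seqset. }
  exists m; split; [|split; [|split; [|split]]]; auto.
  - destruct (Hi w2 Hw2) as (a & Ha & I); exists a; split; auto.
    now apply holds_IsInter.
  - intros x y v Hx Hy Hv HvH.
    assert (HF : holds (Subset (F (upair x y)) m)).
    { apply Cm; split; [|apply finite_upair].
      intros z [-> | ->]%mem_upair; auto. }
    rewrite holds_Subset in HF; apply HF; unfold F.
    specialize (Hc (upair x y) (ex_intro _ (x, y) eq_refl)).
    destruct (c (upair x y)) as [x' y']; cbn in Hc.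
    assert (Hv' : In v (vals x' y' ++ vals y' x')).
    { apply in_or_app; apply upair_inj in Hc as [[<- <-]|[<- <-]]; auto. }
    destruct (In_nth _ _ d Hv') as (n & _ & Hn).
    apply mem_seqset; exists n; rewrite Hn; unfold gd.
    now destruct excluded_middle_informative.
Qed.

(** The extra closure function [E] serves forcings of size omega_1: if it
    enumerates the conditions along omega_1, they all lie in [m]. *)
Lemma approximation_from_generics (V : universe) (P : forcing V) (E : V -> V) (theta0 : V) :
  IGMP_omega2 V -> preserves_omega1 P -> ordinal theta0 ->
  (forall theta m, regular theta -> mem theta0 theta -> elementary m (H theta) ->
    mem (opair (cond P) (leq P)) m ->
    (forall w1, holds (IsOmega1 w1) -> holds (Subset w1 m) /\ holds (Equipotent m w1)) ->
    (forall x, mem x m -> mem (E x) (cond P) -> mem (E x) m) ->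
    forall p, mem p m -> mem p (cond P) ->
      exists q, le P q p /\ generic_condition P m q) ->
  omega1_approximation P.
Proof.
  intros HI HP O0 HG p sigma Hp HB HA.
  apply forces_density; intros q0 Hq0.
  (* [q1] decides which ground set bounds [sigma]. *)
  assert (exists q1 y, le P q1 q0 /\ forces P q1 (Subset sigma (check P y)))
    as (q1 & y & Hq1 & Hy).
  { unfold BoundedInGround in HB; rewrite forces_Ex in HB.
    destruct (HB q0 Hq0) as (r & Hr & tau & Gt & St).
    destruct (Gt r (le_refl_l Hr)) as (q1 & Hq1 & y & E1).
    exists q1, y; split; [apply (le_trans Hq1 Hr)|].
    apply (congruent_Subset_r E1), (forces_mono St Hq1). }
  assert (Cq1 : mem q1 (cond P)) by apply (le_cond Hq1).
  assert (Hyin : forall r z, le P r q1 -> forces P r (Mem (check P z) sigma) -> mem z y).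
  { intros r z Hr Hz; apply (@forces_check_mem_inv _ P r); [apply (le_cond Hr)|].
    unfold Subset in Hy; rewrite forces_AllIn in Hy; auto. }
  destruct (hartogs (V := V) omega) as [w1 Hw1]; apply hartogs_omega1 in Hw1.
  destruct (hartogs w1) as [w2 Hw2].
  destruct (hartogs_omega2 Hw1 Hw2) as [Hw2' Hw12]; clear Hw2; rename Hw2' into Hw2.
  assert (O2 : ordinal w2) by (apply holds_IsOmega2 in Hw2; apply Hw2).
  (* Coding the parameters in one tuple puts each of them into the transitive set [A]; for the
     ordinal [theta0] this gives membership in [theta]. *)
  destruct (large_regular (opair (opair (cond P) (leq P)) (opair w2 (opair y theta0))))
    as (A & theta & TA & Hseed & Rt & HH & OA).
  apply opair_in_transitive in Hseed
    as [AP [A2 [Ay A0]%opair_in_transitive]%opair_in_transitive]; auto.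
  assert (AC : mem (cond P) A) by (apply (opair_in_transitive TA) in AP; apply AP).
  pose (D1 := inter_deciders P sigma q1).
  pose (B a r := epsilon (inhabits y)
    (fun b => forces P r (IsInter (check P b) (check P a) sigma))).
  pose (D2 := eq_deciders P sigma q1 y).
  pose (Z u r := epsilon (inhabits y) (differs_at P sigma y u r)).
  (* The first four entries are constants. [B] chooses the intersection that a condition decides,
     and [Z] a point of disagreement. *)
  pose (vals x z :=
    [opair (cond P) (leq P); w1; y; q1; D1 x; D2 x; B x z; Z x z; E x]).
  destruct (@stationary_closed V theta w2 indestructibly_guessing vals)
    as (m & Hm & [_ Gm] & Em & (a & Ha & Ia) & Cm); auto.
  { apply (HI w2 theta); auto; apply holds_Subset; intros z Hz.
    apply OA; [apply (TA w2) | apply (ordinal_mem O2)]; auto. }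
  { exists y; apply HH, TA, Ay. }
  assert (HAm : forall x, mem x A -> H theta x) by (intros x Hx; apply HH, TA, Hx).
  destruct (proj1 Em) as [x0 Hx0].
  assert (Cc : forall v, In v [opair (cond P) (leq P); w1; y; q1] -> mem v m).
  { intros v Hv; apply (Cm x0 x0); auto.
    - apply (in_or_app [_; _; _; _] _ v); auto.
    - apply HAm; destruct Hv as [<- |[<- |[<- |[<- |[]]]]]; auto.
      + apply (TA w2); auto.
      + apply (TA (cond P)); auto. }
  (* [m] meets [w2] in an ordinal [a] having [w1] as an element, and [a] is transitive. *)
  assert (W1m : forall z, mem z w1 -> mem z m).
  { intros z Hz; apply Ia; apply (proj2 O2 a Ha w1); auto.
    apply Ia; split; auto; apply Cc; cbn; auto. }
  assert (Sm : forall w, holds (IsOmega1 w) -> holds (Subset w m) /\ holds (Equipotent m w)).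
  { intros w Hw; rewrite (omega1_unique Hw Hw1); split; [now apply holds_Subset|].
    split; apply holds_Injects; [|now apply inj_subset].
    apply (lt_omega2_inj_omega1 Hw2 Hw1), Hm, Hw2. }
  destruct (HG theta m Rt (OA _ A0 O0) Em (Cc _ (or_introl eq_refl)) Sm) with (p := q1)
    as (q & Hq & Cq & Gq); [|apply Cc; cbn; auto 6|easy|].
  { intros x Hx HE; apply (Cm x x); auto; [cbn; tauto|].
    apply HAm, (TA (cond P)); auto. }
  assert (Hsubcond : forall Q, H theta (sep Q (cond P))).
  { intros Q; apply HH; intros z Hz; apply mem_sep in Hz as [Hz _].
    apply (TA (cond P)); auto. }
  (* Guessing survives in the extension and is applied there to [sigma], in the direction from
     countable intersections to a guess. *)
  specialize (Gm P HP q Cq); unfold Guessing in Gm; rewrite forces_All in Gm.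
  specialize (Gm sigma).
  rewrite forces_Imp in Gm; specialize (Gm q (leq_refl Cq)).
  assert (Bq : forces P q (BoundedIn sigma (check P m))).
  { apply forces_ExIn_intro with (check P y); [apply forces_check_mem, Cc; cbn; auto|].
    apply (forces_mono Hy Hq). }
  destruct (proj1 (forces_Iff _ _ _ _) (Gm Bq) q (leq_refl Cq)) as [GR _]; clear Gm Bq.
  assert (R : exists r u, le P r q /\ mem u m /\ forall z, mem z m ->
    (mem z u -> forces P r (Mem (check P z) sigma)) /\
    (~ mem z u -> forces P r (Not (Mem (check P z) sigma)))).
  { rewrite forces_ExIn in GR.
    destruct GR with (q := q) as (r & Hr & tau & Ht & Gt).
    (* A countable element of [check P m] is densely some [check P b] with [b] in [m], and [b] is
       countable in V because omega_1 is preserved. *)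
    - apply forces_AllIn; intros tau q2 Hq2 Ht; apply forces_Imp; intros q3 Hq3 Hc.
      apply forces_density; intros q4 Hq4; rewrite forces_Mem_check in Ht.
      destruct (Ht q4) as (r & Hr & b & Hb & Eb); [apply (le_trans Hq4 Hq3)|].
      assert (Lr : le P r q3) by apply (le_trans Hr Hq4).
      assert (Lq : le P r q) by apply (le_trans Lr (le_trans Hq3 Hq2)).
      assert (Cb : inj b omega).
      { apply (@forces_Countable_check _ P r); auto; [apply (le_cond Hr)|].
        apply (congruent_Countable Eb), (forces_mono Hc Lr). }
      (* Some [d] in [m] from [D1 b] is compatible with [r]; the common extension [r'] is below
         [q1], so [d] decides the intersection. *)
      destruct (Gq (D1 b)) with (r := r) as (d & Hd & HD & r' & H1 & H2); auto.
      + apply (Cm b b); auto; [cbn; tauto | apply Hsubcond].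
      + apply inter_deciders_dense.
        refine (forces_mono (HA b (proj2 (holds_Countable b) Cb)) _).
        apply (le_trans Hq1 Hq0).
      + apply mem_sep in HD as [_ [HD|HD]].
        2: { destruct HD; exists r'; split; auto; apply (le_trans H1), (le_trans Lq Hq). }
        apply (epsilon_spec (inhabits y)) in HD; fold (B b d) in HD.
        exists r'; split; [apply (le_trans H1 Hr)|].
        (* [b] and [d] are in [m], and [B b d] is a subset of [y], hence in H_theta; closure puts it
           in [m]. *)
        apply forces_ExIn_intro with (check P (B b d)).
        * apply forces_check_mem, (Cm b d); auto; [cbn; tauto|].
          apply HH; intros z Hz; apply (TA y Ay), (Hyin r').
          -- apply (le_trans H1), (le_trans Lq Hq).
          -- unfold IsInter in HD; rewrite forces_All in HD.
             specialize (forces_mono (HD (check P z)) H2); rewrite forces_Iff.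
             intros K; apply (K r' (le_refl_l H1)), forces_check_mem, Hz.
        * apply (congruent_IsInter (forces_eq_sym (forces_eq_mono Eb H1))).
          apply (forces_mono HD H2).
    - apply leq_refl, Cq.
    - rewrite forces_Mem_check in Ht.
      destruct (Ht r (le_refl_l Hr)) as (r' & Hr' & u & Hu & Eu).
      exists r', u; split; [apply (le_trans Hr' Hr)|]; split; auto; intros z Hz.
      rewrite forces_All in Gt.
      specialize (forces_mono (Gt (check P z)) Hr'); rewrite forces_Iff; intros K.
      split; intros Hzu.
      + apply (K r' (le_refl_l Hr')); split; [|now apply forces_check_mem].
        apply (congruent_Mem_r (forces_eq_sym Eu)), forces_check_mem, Hzu.
      + intros s Hs Hf; apply Hzu; apply (@forces_check_mem_inv _ P s); [apply (le_cond Hs)|].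
        apply (congruent_Mem_r (forces_eq_mono Eu Hs)).
        apply (K s Hs); split; [easy | now apply forces_check_mem]. }
  destruct R as (r & u & Hr & Hu & HR).
  assert (Lq1 : le P r q1) by apply (le_trans Hr Hq).
  (* Genericity again, now for [D2 u], which is in [m] because [u] is. *)
  destruct (Gq (D2 u)) with (r := r) as (d & Hd & HD & r' & H1 & H2); auto.
  - apply (Cm u u); auto; [cbn; tauto | apply Hsubcond].
  - now apply eq_deciders_dense.
  - exists r'; split; [apply (le_trans H1), (le_trans Lq1 Hq1)|].
    apply mem_sep in HD as [_ [HD|[HD|HD]]].
    + intros s Hs; exists s; split; [apply (le_refl_l Hs)|]; eexists.
      apply (forces_eq_mono HD), (le_trans Hs H2).
    (* The point [Z u d] belongs to [m], where [r] forces [sigma] to agree with [u], while [d]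
       forces a disagreement; [r'] would force both. *)
    + exfalso; apply (epsilon_spec (inhabits y)) in HD; fold (Z u d) in HD.
      destruct HD as [Hzy HZ].
      assert (Zm : mem (Z u d) m).
      { apply (Cm u d); auto; [cbn; tauto|]; apply HAm, (TA y); auto. }
      destruct (HR (Z u d) Zm) as [HR1 HR2]; destruct HZ as [[Nz Fz]|[Hz Fz]].
      * apply (HR2 Nz r' H1), (forces_mono Fz H2).
      * apply (Fz r' H2), (forces_mono (HR1 Hz) H1).
    + destruct HD; exists r'; split; [easy | apply (le_trans H1 Lq1)].
Qed.

(** * The two classes of forcings *)

Unset Implicit Arguments.

Theorem theorem2p5 (V : universe) (HIGMP : IGMP_omega2 V) :
  (forall P : forcing V,
     preserves_omega1 P -> proper_for_size_omega1 P -> omega1_approximation P) /\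
  (forall P : forcing V,
     preserves_omega1 P -> has_size_omega1 P -> omega1_approximation P).
Proof.
  split; intros P HP HS.
  - destruct HS as (theta0 & O0 & HS); apply holds_Ordinal in O0.
    apply (@approximation_from_generics V P (fun x => x) theta0); auto.
    intros theta m Rt Ht Em Pm Sm _; exact (HS theta Rt Ht m Em Pm Sm).
  - destruct (hartogs (V := V) omega) as [w1 Hw1]; apply hartogs_omega1 in Hw1.
    destruct (proj1 (holds_Injects _ _) (proj1 (HS w1 Hw1))) as (f & Hf & If).
    (* [g] inverts the injection of the conditions into omega_1; as omega_1 is a subset of [m],
       closure under [g] puts every condition into [m]. *)
    destruct (choose (fun x p => mem p (cond P) /\ f p = x) empty) as [g Hg].
    apply (@approximation_from_generics V P g empty); auto.
    { split; intros y Hy; destruct (mem_empty Hy). }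
    intros theta m _ _ _ _ Sm Cm p Hpm Hp.
    assert (HPm : forall r, mem r (cond P) -> mem r m).
    { intros r Hr; destruct (Hg (f r)) as [Hc E]; [eauto|].
      apply If in E; auto; specialize (Cm (f r)); rewrite E in Cm; apply Cm; auto.
      destruct (Sm w1 Hw1) as [Hs _]; rewrite holds_Subset in Hs; auto. }
    (* All conditions being in [m], [p] itself is generic: any [d] in [D] below [r] lies in [m] and
       witnesses its own compatibility with [r]. *)
    exists p; split; [now apply leq_refl|]; split; auto.
    intros D HD [HDc Dd] r Hr.
    destruct (Dd r (proj1 (le_cond Hr))) as (d & Hd & Hdr).
    exists d; split; auto; split; auto; exists d; split; auto.
    now apply leq_refl, HDc.
Qed.
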